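(* Let $N\ge 2$ be an integer and $R>0$. Let $D$ be the chord length of the $N$-sphere of radius $R$, i.e. $D=\|p_1-p_2\|$ where $p_1,p_2$ are independent and uniformly distributed on the $N$-sphere of radius $R$. Then $D$ has the probability density function $$f_N(d)=\frac{d}{R^2\,B\left(\frac{N-1}{2},\frac12\right)}\left(\frac{d^2}{R^2}-\frac{d^4}{4R^4}\right)^{\frac{N-3}{2}},\qquad 0<d<2R$$ (and $D$ is supported in $[0,2R]$).
   Context: The $N$-sphere of radius $R$ means the hypersphere $\{x\in\mathbb{R}^N: x_1^2+\dots+x_N^2=R^2\}$ in $N$-dimensional Euclidean space; ''uniformly distributed'' refers to the normalized surface measure on it. $\|\cdot\|$ is the Euclidean norm. $B(a,b)=\int_0^1 t^{a-1}(1-t)^{b-1}dt$ is the beta function. *)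

(* Defs.v *)
From HB Require Import structures.
From mathcomp Require Import all_boot all_order all_algebra.
From mathcomp Require Import all_classical all_reals all_analysis.

Set Implicit Arguments.
Unset Strict Implicit.
Unset Printing Implicit Defensive.

Import Order.TTheory GRing.Theory Num.Theory.
Import numFieldNormedType.Exports.

Local Open Scope classical_set_scope.
Local Open Scope ring_scope.

(* Points of R^n are n-tuples: the library equips [n.-tuple R] with the
   sigma-algebra generated by the coordinates, i.e. the Borel sets of R^n.
   The norm of ['rV[R]_n] is the sup norm, hence the explicit Euclidean one. *)
Definition eucl_dist (R : realType) (n : nat) (x y : n.-tuple R) : R :=
  Num.sqrt (\sum_(i < n) (tnth x i - tnth y i) ^+ 2).

Definition sphere (R : realType) (n : nat) (r : R) : set (n.-tuple R) :=
  [set x | \sum_(i < n) tnth x i ^+ 2 = r ^+ 2].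
Arguments sphere {R} n r.

(* The extra value 0 only serves to give the empty set diameter 0. *)
Definition eucl_diam (R : realType) (n : nat) (A : set (n.-tuple R)) : \bar R :=
  ereal_sup (0%E |` [set (eucl_dist x y)%:E | x in A & y in A]).

Definition hausdorff_delta (R : realType) (n s : nat) (delta : R)
    (A : set (n.-tuple R)) : \bar R :=
  ereal_inf [set (\sum_(0 <= k <oo) eucl_diam (F k) ^+ s)%E |
    F in [set F : nat -> set (n.-tuple R) |
      A `<=` \bigcup_k F k /\
      forall k, (eucl_diam (F k) <= delta%:E)%E]].

(* The s-dimensional Hausdorff (outer) measure on R^n, for 0 < s, without the
   conventional constant factor, which cancels in [sphere_unif]. *)
Definition hausdorff_measure (R : realType) (n s : nat) (A : set (n.-tuple R)) :
    \bar R :=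
  ereal_sup [set hausdorff_delta s delta A | delta in [set delta : R | 0 < delta]].

(* Normalized surface measure, the surface measure being the (n - 1)-dimensional
   Hausdorff measure. Were the area of the sphere 0 or +oo, this quotient would
   be 0 on the whole space, so it could not be the law of a random vector. *)
Definition sphere_unif (R : realType) (n : nat) (r : R) (A : set (n.-tuple R)) :
    \bar R :=
  (hausdorff_measure n.-1 (A `&` sphere n r) /
   hausdorff_measure n.-1 (sphere n r))%E.

Definition uniform_on_sphere (R : realType) (d : measure_display)
    (T : measurableType d) (P : probability T R) (n : nat) (r : R)
    (X : {RV P >-> n.-tuple R}) : Prop :=
  forall A : set (n.-tuple R), measurable A ->
    distribution P X A = sphere_unif r A.

Definition independent_RV (R : realType) (d d1 d2 : measure_display)
    (T : measurableType d) (T1 : measurableType d1) (T2 : measurableType d2)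
    (P : probability T R) (X : {RV P >-> T1}) (Y : {RV P >-> T2}) : Prop :=
  forall (A : set T1) (B : set T2), measurable A -> measurable B ->
    P (X @^-1` A `&` Y @^-1` B) = (P (X @^-1` A) * P (Y @^-1` B))%E.

Definition has_pdf (R : realType) (d : measure_display) (T : measurableType d)
    (P : probability T R) (D : T -> R) (f : R -> R) : Prop :=
  [/\ measurable_fun setT D,
      measurable_fun setT f,
      (forall x, 0 <= f x) &
      forall A : set R, measurable A ->
        P (D @^-1` A) = (\int[lebesgue_measure]_(x in A) (f x)%:E)%E].

(* The library's [beta_fun] only takes natural arguments. *)
Definition Beta (R : realType) (a b : R) : R :=
  \int[lebesgue_measure]_(t in `[0, 1]) (t `^ (a - 1) * (1 - t) `^ (b - 1)).

Definition chord_pdf (R : realType) (n : nat) (r x : R) : R :=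
  if (0 < x) && (x < 2 * r) then
    x / (r ^+ 2 * Beta ((n%:R - 1) / 2) (1 / 2)) *
    (x ^+ 2 / r ^+ 2 - x ^+ 4 / (4 * r ^+ 4)) `^ ((n%:R - 3) / 2)
  else 0.

(* Main.v *)
Require Import Defs.
From HB Require Import structures.
From mathcomp Require Import all_boot all_order all_algebra.
From mathcomp Require Import all_classical all_reals all_analysis.
From mathcomp Require Import measurable_realfun ring lra.

Set Implicit Arguments.
Unset Strict Implicit.
Unset Printing Implicit Defensive.

Import Order.TTheory GRing.Theory Num.Theory.
Import numFieldNormedType.Exports.

Local Open Scope classical_set_scope.
Local Open Scope ring_scope.

(** A uniform point X of the sphere enters only through the invariance of its
    law under Householder reflections: the law of <X, y> depends on |y| alone,
    so E <X, y>^k = c_k |y|^k.  Expanding this at y + u e_i, comparing the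
    coefficients of u^2 and summing over i gives a recursion for the moments of
    <X, y>; it is the recursion satisfied by the moments of cos under the
    density proportional to sin^(N-2) on [0, pi].  On a bounded interval the
    moments determine the law, so <X, y> / r^2 is distributed as the cosine of
    that random angle when |y| = r.  By Fubini the same holds for <p1, p2> / r^2,
    and the chord length is 2 r sin(angle / 2); substitution gives the density,
    and t = sin^2 turns the Beta integral into the normalizing constant. *)

(** * Isometries and reflections *)

Section isometries.
Context {R : realType} {n : nat}.
Implicit Types (A : set (n.-tuple R)) (x y u : n.-tuple R).

(** The surface measure is a Hausdorff measure, known only through distances between points, and
    neither a parametrization nor the area of the sphere is ever computed. All that is extracted
    from [uniform_on_sphere] is that the law sits on the sphere and is invariant under involutive
    isometries preserving it. Reflections are enough because one of them exchanges any two given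
    vectors of equal norm. Moments take the place of densities for the same reason: after division
    by r^2, the even moments of [dot_momentS] with N = n + 2 obey the recursion [trig_momentS], both
    families start at 1 once normalized, and the odd moments vanish on both sides. In the last
    sections the dimension is therefore written n + 2, so that n is the exponent of the sine. A
    second obstacle is N = 2, where the chord density is unbounded near 2r and the Beta integrand at
    both ends of [0, 1]. The substitutions are made on open intervals, exhausted by closed ones. *)

Definition isometry (f : n.-tuple R -> n.-tuple R) :=
  forall x y, eucl_dist (f x) (f y) = eucl_dist x y.

Lemma eucl_diam_isometry f A : isometry f ->
  eucl_diam (f @` A) = eucl_diam A.
Proof.
move=> isof; congr (ereal_sup (_ `|` _)); apply/seteqP; split => z /=.
- by move=> [_ [x Ax <-]] [_ [y Ay <-]] <-; exists x => //; exists y; rewrite ?isof.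
- move=> [x Ax] [y Ay] <-; exists (f x); first by exists x.
  by exists (f y); [exists y|rewrite isof].
Qed.

(** The images of the sets of a cover again form a cover, with the same diameters. The reverse
    inequality needs an inverse of [f]; for an involution it follows by applying this one to the
    image of [A]. *)
Lemma hausdorff_delta_isometry s delta f A : isometry f ->
  (hausdorff_delta s delta (f @` A) <= hausdorff_delta s delta A)%E.
Proof.
move=> isof; apply: ereal_inf_le_tmp => _ [F [AF dF] <-].
exists (fun k => f @` F k).
  split=> [_ [x Ax <-]|k]; last by rewrite eucl_diam_isometry.
  by have [k _ Fkx] := AF _ Ax; exists k => //; exists x.
by apply: eq_eseriesr => k _; rewrite eucl_diam_isometry.
Qed.

Lemma hausdorff_measure_isometry s f A : isometry f -> involutive f ->
  hausdorff_measure s (f @` A) = hausdorff_measure s A.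
Proof.
move=> isof ff; congr (ereal_sup _); apply: eq_imagel => delta _.
apply/eqP; rewrite eq_le hausdorff_delta_isometry//=.
have -> : hausdorff_delta s delta A = hausdorff_delta s delta (f @` (f @` A)).
  by rewrite image_comp (_ : f \o f = id) ?image_id//; apply/funext.
exact: hausdorff_delta_isometry.
Qed.

(** As [f] is its own inverse and preserves the sphere, the part of the preimage of [A] on the
    sphere is the image under [f] of the part of [A] on the sphere. *)
Lemma sphere_unif_isometry (r : R) f A : isometry f -> involutive f ->
  f @` sphere n r = sphere n r ->
  sphere_unif r (f @^-1` A) = sphere_unif r A.
Proof.
move=> isof ff fS; congr (_ / _)%E.
rewrite -[RHS](hausdorff_measure_isometry _ _ isof ff); congr hausdorff_measure.
apply/seteqP; split => [x [Afx Sx]|_ [x [Ax Sx] <-]].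
  by exists (f x); rewrite ?ff//; split=> //; rewrite -fS; exists x.
by split; [rewrite /= ff|rewrite -fS; exists x].
Qed.

Definition dot x y : R := \sum_(i < n) tnth x i * tnth y i.

(** The only vector operation used on tuples; a scalar multiple of y is written
    [lincomb a y 0 y]. *)
Definition lincomb (a : R) x (b : R) y : n.-tuple R :=
  [tuple a * tnth x i + b * tnth y i | i < n].

Lemma dotC x y : dot x y = dot y x.
Proof. by apply: eq_bigr => i _; rewrite mulrC. Qed.

Lemma dot_lincombr a b x y u :
  dot u (lincomb a x b y) = a * dot u x + b * dot u y.
Proof.
rewrite /dot !mulr_sumr -big_split/=; apply: eq_bigr => i _.
by rewrite tnth_mktuple; ring.
Qed.

Lemma dot_lincombl a b x y u :
  dot (lincomb a x b y) u = a * dot x u + b * dot y u.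
Proof. by rewrite dotC dot_lincombr !(dotC u). Qed.

Lemma dot_ge0 x : 0 <= dot x x.
Proof. by apply: sumr_ge0 => i _; rewrite -expr2 sqr_ge0. Qed.

Lemma sphereE (r : R) x : sphere n r x <-> dot x x = r ^+ 2.
Proof.
by rewrite /sphere/= /dot; under eq_bigr do rewrite expr2.
Qed.

Lemma eucl_distE x y : eucl_dist x y =
  Num.sqrt (dot x x - 2 * dot x y + dot y y).
Proof.
congr Num.sqrt; rewrite /dot mulr_sumr -sumrB -big_split/=.
by apply: eq_bigr => i _; ring.
Qed.

(** Householder reflection in the hyperplane orthogonal to u. For u = 0 the division by zero gives 0
    and the map is the identity, so the lemmas below hold for every u. *)
Definition reflection u x := lincomb 1 x (- (2 * dot x u / dot u u)) u.

Lemma reflectionK u : involutive (reflection u).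
Proof.
move=> x; apply: eq_from_tnth => i; rewrite /reflection !tnth_mktuple.
rewrite dot_lincombl; have [u0|u0] := eqVneq (dot u u) 0.
  by rewrite u0 !(invr0, mulr0, oppr0, mul0r, addr0, mul1r).
by field.
Qed.

Lemma dot_reflectionl u x y : dot (reflection u x) y = dot x (reflection u y).
Proof. by rewrite dot_lincombl dot_lincombr (dotC u y); ring. Qed.

Lemma dot_reflection u x y : dot (reflection u x) (reflection u y) = dot x y.
Proof. by rewrite dot_reflectionl reflectionK. Qed.

Lemma reflection_isometry u : isometry (reflection u).
Proof. by move=> x y; rewrite !eucl_distE !dot_reflection. Qed.

Lemma reflection_sphere u r : reflection u @` sphere n r = sphere n r.
Proof.
apply/seteqP; split => [_ [x Sx <-]|x Sx].
  by apply/sphereE; rewrite dot_reflection; exact/sphereE.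
exists (reflection u x); last by rewrite reflectionK.
by apply/sphereE; rewrite dot_reflection; exact/sphereE.
Qed.

(** With u = x - y, equality of the norms gives <u, u> = 2 <x, u>, so the coefficient of u is -1 and
    x is sent to x - u = y. *)
Lemma reflection_swap x y : dot x x = dot y y ->
  reflection (lincomb 1 x (-1) y) x = y.
Proof.
move=> xy; set u := lincomb _ _ _ _.
have uE : dot u u = 2 * dot x u.
  by rewrite /u !(dot_lincombl, dot_lincombr) (dotC y x) xy; ring.
apply: eq_from_tnth => i; rewrite tnth_mktuple -uE.
have [u0|u0] := eqVneq (dot u u) 0; last by rewrite divff// tnth_mktuple; ring.
rewrite u0 mul0r oppr0 mul0r addr0 mul1r; apply/eqP; rewrite -subr_eq0.
(* In the degenerate case <u, u> = 0 the reflection fixes x, and all coordinates of x - y vanish. *)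
have : \sum_(j < n) tnth u j ^+ 2 == 0.
  by under eq_bigr do rewrite expr2; exact/eqP.
rewrite psumr_eq0; last by move=> j _; rewrite sqr_ge0.
move=> /allP /(_ i (mem_index_enum i)); rewrite sqrf_eq0 tnth_mktuple.
by rewrite mul1r mulN1r.
Qed.

Lemma measurable_dot d (T : measurableType d) (f g : T -> n.-tuple R) :
  measurable_fun setT f -> measurable_fun setT g ->
  measurable_fun setT (fun t => dot (f t) (g t)).
Proof.
move=> /measurable_fun_tnthP mf /measurable_fun_tnthP mg.
by apply: measurable_sum => i; apply: measurable_funM; [exact: mf|exact: mg].
Qed.

Lemma measurable_sphere (r : R) : measurable (sphere n r).
Proof.
rewrite (_ : sphere n r = (fun x => dot x x) @^-1` [set r ^+ 2]); last first.
  by apply/seteqP; split => x /sphereE.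
rewrite -[X in measurable X]setTI.
have mdot : measurable_fun setT (fun x : n.-tuple R => dot x x) by exact: measurable_dot.
exact: mdot.
Qed.

End isometries.

(** * Laws determined by their moments *)

Section bounded_random_variables.
Context d (T : measurableType d) (R : realType) (P : probability T R).
Implicit Types f g : T -> R.

(** The bound holds only almost everywhere because a uniform point lies on the sphere only almost
    surely. The class is stable under sums and products, hence under polynomials, and its members
    are integrable. *)
Definition ae_bounded f := measurable_fun setT f /\
  exists M, {ae P, forall t, `|f t| <= M}.

Lemma ae_bounded_integrable f :
  ae_bounded f -> P.-integrable setT (EFin \o f).
Proof.
move=> [mf [M fM]]; apply/integrableP; split; first exact/measurable_EFinP.
apply: (@le_lt_trans _ _ (`|M|%:E * P setT)%E); last first.
  by rewrite probability_setT mule1 ltry.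
apply: integral_le_bound => //; first exact/measurable_EFinP.
apply: filterS fM => t fM _.
by rewrite lee_fin (le_trans fM)// ler_norm.
Qed.

Lemma ae_bounded_cst c : ae_bounded (cst c).
Proof. by split => //; exists `|c|; exact: aeW. Qed.

Lemma ae_boundedD f g : ae_bounded f -> ae_bounded g ->
  ae_bounded (fun t => f t + g t).
Proof.
move=> [mf [M fM]] [mg [K gK]]; split; first exact: measurable_funD.
by exists (M + K); apply: filterS2 fM gK => t *; rewrite (le_trans (ler_normD _ _))// lerD.
Qed.

Lemma ae_boundedM f g : ae_bounded f -> ae_bounded g ->
  ae_bounded (fun t => f t * g t).
Proof.
move=> [mf [M fM]] [mg [K gK]]; split; first exact: measurable_funM.
by exists (M * K); apply: filterS2 fM gK => t *; rewrite normrM ler_pM.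
Qed.

Lemma ae_boundedX f k : ae_bounded f -> ae_bounded (fun t => f t ^+ k).
Proof.
move=> bf; elim: k => [|k IH]; first exact: (ae_bounded_cst 1).
by under eq_fun do rewrite exprS; exact: ae_boundedM.
Qed.

Lemma ae_bounded_sum I (s : seq I) (F : I -> T -> R) :
  (forall i, ae_bounded (F i)) -> ae_bounded (fun t => \sum_(i <- s) F i t).
Proof.
move=> bF; elim: s => [|i s IH].
  by under eq_fun do rewrite big_nil; exact: ae_bounded_cst.
by under eq_fun do rewrite big_cons; exact: ae_boundedD.
Qed.

Lemma ae_bounded_horner f (p : {poly R}) :
  ae_bounded f -> ae_bounded (fun t => p.[f t]).
Proof.
move=> bf; under eq_fun do rewrite horner_coef.
by apply: ae_bounded_sum => i; apply: ae_boundedM;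
  [exact: ae_bounded_cst|exact: ae_boundedX].
Qed.

Lemma ae_bounded_indic A : measurable A -> ae_bounded \1_A.
Proof.
move=> mA; split; first exact: measurable_indic.
by exists 1; apply: aeW => t; rewrite indicE; case: (_ \in _); rewrite ?normr0 ?normr1.
Qed.

Lemma Rintegral_sum I (s : seq I) (F : I -> T -> R) :
  (forall i, ae_bounded (F i)) ->
  \int[P]_t (\sum_(i <- s) F i t) = \sum_(i <- s) \int[P]_t F i t.
Proof.
move=> bF; elim: s => [|i s IH].
  by rewrite big_nil; under eq_Rintegral do rewrite big_nil; rewrite Rintegral_cst// mul0r.
rewrite big_cons -IH; under eq_Rintegral do rewrite big_cons.
by rewrite RintegralD//; apply: ae_bounded_integrable => //; exact: ae_bounded_sum.
Qed.

Lemma Rintegral_horner f (p : {poly R}) : ae_bounded f ->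
  \int[P]_t p.[f t] = \sum_(i < size p) p`_i * \int[P]_t f t ^+ i.
Proof.
move=> bf; under eq_Rintegral do rewrite horner_coef.
rewrite Rintegral_sum; last first.
  by move=> i; apply: ae_boundedM; [exact: ae_bounded_cst|exact: ae_boundedX].
apply: eq_bigr => i _; rewrite RintegralZl//.
by apply: ae_bounded_integrable; exact: ae_boundedX.
Qed.

Lemma ae_le_Rintegral f g : ae_bounded f -> ae_bounded g ->
  {ae P, forall t, f t <= g t} -> \int[P]_t f t <= \int[P]_t g t.
Proof.
move=> bf bg fg; rewrite -subr_ge0 -RintegralB//; try exact: ae_bounded_integrable.
have mgf : measurable_fun setT (fun t => g t - f t).
  by apply: measurable_funB; [case: bg|case: bf].
(* The difference is nonnegative only almost everywhere; its positive part has the same integral and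
   is nonnegative everywhere. *)
have -> : \int[P]_t (g t - f t) = \int[P]_t Num.max 0 (g t - f t).
  congr fine; apply: ae_eq_integral => //.
  - exact/measurable_EFinP.
  - exact/measurable_EFinP/measurable_maxr.
  - by apply: filterS fg => t fg _; rewrite max_r// subr_ge0.
by apply: Rintegral_ge0 => t _; rewrite le_max lexx.
Qed.

Lemma Rintegral_indic A : measurable A -> \int[P]_t \1_A t = fine (P A).
Proof. by move=> mA; rewrite /Rintegral integral_indic// setIT. Qed.

End bounded_random_variables.

Lemma ae_eq_probability d (T : measurableType d) (R : realType) (P : probability T R)
    (A B : set T) : measurable A -> measurable B ->
  {ae P, forall t, A t <-> B t} -> P A = P B.
Proof.
move=> mA mB AB; rewrite -(setIT A) -(setIT B) -!integral_indic//.
apply: ae_eq_integral => //.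
- exact/measurable_EFinP/measurable_indic.
- exact/measurable_EFinP/measurable_indic.
- apply: filterS AB => t AB _; rewrite !indicE.
  by congr (_%:R%:E); congr nat_of_bool; apply/idP/idP; rewrite !inE => /AB.
Qed.

(** * Polynomial steps, and uniqueness of a bounded law with given moments *)

Section moments.
Context {R : realType}.

Lemma bernoulli_inequality (t : R) n : -1 <= t -> 1 + n%:R * t <= (1 + t) ^+ n.
Proof.
move=> t1; elim: n => [|n IH]; first by rewrite mul0r addr0.
rewrite exprS; apply: (@le_trans _ _ ((1 + t) * (1 + n%:R * t))); last first.
  by apply: ler_wpM2l => //; lra.
have : 0 <= n%:R * t ^+ 2 by rewrite mulr_ge0// sqr_ge0.
by rewrite -natr1; lra.
Qed.

(* A step with threshold w = 1 / k on [0, 1], as n tends to infinity. *)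
Definition step_val (w : R) (k n : nat) : R := (1 - w ^+ n) ^+ (k ^ n).

Lemma step_val_itv w k n : 0 <= w <= 1 -> 0 <= step_val w k n <= 1.
Proof.
move=> /andP[w0 w1]; have := exprn_ile1 n w0 w1; have := exprn_ge0 n w0 => u0 u1.
by rewrite exprn_ge0 ?exprn_ile1//; lra.
Qed.

(** Bernoulli's inequality bounds (1 - w^n)^(k^n) below by 1 - (k w)^n. Below the threshold, where
    rho < 1, this tends to 1. *)
Lemma step_val_ge w k n rho : 0 <= w <= 1 -> k%:R * w <= rho ->
  1 - rho ^+ n <= step_val w k n.
Proof.
move=> /andP[w0 w1] kw.
apply: (@le_trans _ _ (1 + (k ^ n)%:R * - w ^+ n)); last first.
  by apply: bernoulli_inequality; rewrite lerN2 exprn_ile1.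
rewrite lerD2l mulrN lerN2 natrX -exprMn lerXn2r// nnegrE ?mulr_ge0//.
by rewrite (le_trans _ kw)// mulr_ge0.
Qed.

(** Multiplied by (1 + w^n)^(k^n), the step becomes (1 - w^(2n))^(k^n) <= 1, while Bernoulli's
    inequality makes that factor at least (k w)^n >= sigma^n. *)
Lemma step_val_le w k n sigma : 0 <= w <= 1 -> 0 < sigma -> sigma <= k%:R * w ->
  step_val w k n <= sigma^-1 ^+ n.
Proof.
move=> w01 s0 kw; have /andP[w0 w1] := w01.
have u0 : 0 <= w ^+ n by exact: exprn_ge0.
have u1 : w ^+ n <= 1 by exact: exprn_ile1.
rewrite exprVn -[leRHS]mul1r ler_pdivlMr ?exprn_gt0//.
have /andP[q0 q1] := step_val_itv k n w01.
apply: (@le_trans _ _ (step_val w k n * (1 + w ^+ n) ^+ (k ^ n))).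
  apply: ler_wpM2l => //.
  apply: (@le_trans _ _ (1 + (k ^ n)%:R * w ^+ n)).
    rewrite natrX -exprMn.
    have : sigma ^+ n <= (k%:R * w) ^+ n.
      by rewrite lerXn2r// nnegrE ?mulr_ge0// ltW.
    by lra.
  by apply: bernoulli_inequality; lra.
rewrite -exprMn exprn_ile1//; last by nra.
by rewrite mulr_ge0//; lra.
Qed.

(** A polynomial step [p n] that falls from 1 to 0 between y and z has the same integral under both
    laws, since it depends on the moments only. That integral is asymptotically at least the first
    probability and at most the second. *)
Lemma le_cdf_moments d1 d2 (T1 : measurableType d1) (T2 : measurableType d2)
    (P1 : probability T1 R) (P2 : probability T2 R) (f1 : T1 -> R) (f2 : T2 -> R)
    (a b y z : R) :
  measurable_fun setT f1 -> measurable_fun setT f2 ->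
  {ae P1, forall t, a <= f1 t <= b} -> {ae P2, forall t, a <= f2 t <= b} ->
  (forall k, \int[P1]_t f1 t ^+ k = \int[P2]_t f2 t ^+ k) -> y < z ->
  (P1 (f1 @^-1` `]-oo, y]) <= P2 (f2 @^-1` `]-oo, z]))%E.
Proof.
move=> mf1 mf2 f1ab f2ab f12 yz.
(* Lowering the left bound keeps both hypotheses; a <= y makes [rho] below nonnegative, so that its
   powers tend to 0. *)
wlog ay : a f1ab f2ab / a <= y.
  move=> /(_ (Num.min a y)); apply; last by rewrite ge_min lexx orbT.
  - by apply: filterS f1ab => t /andP[? ?]; rewrite ge_min; apply/andP; split => //; apply/orP; left.
  - by apply: filterS f2ab => t /andP[? ?]; rewrite ge_min; apply/andP; split => //; apply/orP; left.
have bnd d (T : measurableType d) (P : probability T R) f :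
    measurable_fun setT f -> {ae P, forall t, a <= f t <= b} -> ae_bounded P f.
  move=> mf fab; split => //; exists (Num.max `|a| `|b|).
  apply: filterS fab => t /andP[af fb]; rewrite ler_norml; apply/andP; split.
    by rewrite lerNl le_max -(normrN a) (le_trans _ (ler_norm (- a))) ?lerN2.
  by rewrite le_max (le_trans fb (ler_norm _)) orbT.
have bf1 := bnd _ _ _ _ mf1 f1ab; have bf2 := bnd _ _ _ _ mf2 f2ab.
(* The drop is placed at the midpoint of y and z, at distance x from a. The map [w] sends [a, b]
   into [0, 1] and the midpoint to the threshold 1 / (k + 1), whence rho < 1 < sigma at y and z. *)
pose x := (y + z) / 2 - a.
have x0 : 0 < x by rewrite /x; lra.
have [k kb] : exists k, b - a <= k.+1%:R * x.
  exists (Num.truncn ((b - a) / x)).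
  by rewrite -ler_pdivrMr// ltW// truncnS_gt.
have c0 : 0 < k.+1%:R * x by rewrite mulr_gt0.
pose w v := (v - a) / (k.+1%:R * x).
have w01 v : a <= v <= b -> 0 <= w v <= 1.
  move=> /andP[av vb]; apply/andP; split.
    by rewrite divr_ge0 ?subr_ge0// ltW.
  by rewrite /w ler_pdivrMr// mul1r (le_trans _ kb)// lerD2r.
have kwE v : k.+1%:R * w v = (v - a) / x.
  by rewrite /w; field; rewrite (gt_eqF x0)/= addrC natr1 pnatr_eq0.
pose rho := (y - a) / x; pose sigma := (z - a) / x.
have rho0 : 0 <= rho by rewrite divr_ge0 ?(ltW x0)// subr_ge0.
have rho1 : rho < 1 by rewrite /rho ltr_pdivrMr// mul1r /x; lra.
have sigma1 : 1 < sigma by rewrite /sigma ltr_pdivlMr// mul1r /x; lra.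
have sigma0 : 0 < sigma by lra.
pose p n : {poly R} :=
  (1 - ((k.+1%:R * x)^-1 *: ('X - a%:P)) ^+ n) ^+ (k.+1 ^ n).
have pE n v : (p n).[v] = step_val (w v) k.+1 n.
  by rewrite /p /step_val !hornerE /w; congr ((1 - _ ^+ _) ^+ _); rewrite mulrC.
have bp1 n : ae_bounded P1 (fun t => (p n).[f1 t]) by exact: ae_bounded_horner.
have bp2 n : ae_bounded P2 (fun t => (p n).[f2 t]) by exact: ae_bounded_horner.
have p12 n : \int[P1]_t (p n).[f1 t] = \int[P2]_t (p n).[f2 t].
  by rewrite !Rintegral_horner//; apply: eq_bigr => i _; rewrite f12.
set A1 := f1 @^-1` _; set A2 := f2 @^-1` _.
have mA1 : measurable A1 by rewrite -[A1]setTI; exact: mf1.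
have mA2 : measurable A2 by rewrite -[A2]setTI; exact: mf2.
(* The polynomial is at least 1 - rho^n where f1 <= y and nonnegative elsewhere on [a, b]. *)
have le1 n : fine (P1 A1) * (1 - rho ^+ n) <= \int[P1]_t (p n).[f1 t].
  rewrite -Rintegral_indic// -RintegralZr//; last first.
    exact/ae_bounded_integrable/ae_bounded_indic.
  apply: ae_le_Rintegral => //.
    by apply: ae_boundedM; [exact: ae_bounded_indic|exact: ae_bounded_cst].
  apply: filterS f1ab => t f1ab; rewrite pE indicE.
  have [A1t|_] := boolP (t \in A1); last first.
    by rewrite mul0r; have /andP[] := step_val_itv k.+1 n (w01 _ f1ab).
  rewrite mul1r step_val_ge ?w01// kwE ler_pM2r ?invr_gt0// lerD2r.
  by move: A1t; rewrite inE /A1/= in_itv.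
(* The polynomial is at most 1 where f2 <= z and at most sigma^(-n) beyond z. *)
have le2 n : \int[P2]_t (p n).[f2 t] <= fine (P2 A2) + sigma^-1 ^+ n.
  have -> : fine (P2 A2) + sigma^-1 ^+ n = \int[P2]_t (\1_A2 t + sigma^-1 ^+ n).
    rewrite RintegralD//.
    - by rewrite Rintegral_indic// Rintegral_cst//= probability_setT mulr1.
    - by apply: ae_bounded_integrable; exact: ae_bounded_indic.
    - by apply: ae_bounded_integrable; exact: ae_bounded_cst.
  apply: ae_le_Rintegral => //.
    by apply: ae_boundedD; [exact: ae_bounded_indic|exact: ae_bounded_cst].
  apply: filterS f2ab => t f2ab; rewrite pE indicE.
  have s0 : 0 <= sigma^-1 ^+ n by rewrite exprn_ge0// invr_ge0 ltW.
  have [A2t|A2t] := boolP (t \in A2).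
    by have /andP[] := step_val_itv k.+1 n (w01 _ f2ab) => *; rewrite -[leLHS]addr0 lerD.
  rewrite add0r step_val_le ?w01// kwE ler_pM2r ?invr_gt0// lerD2r.
  move: A2t; rewrite notin_setE /A2/= in_itv/= => /negP.
  by rewrite -ltNge => /ltW.
rewrite -[leLHS]fineK ?fin_num_measure// -[leRHS]fineK ?fin_num_measure// lee_fin.
apply: (@ler_cvg_to _ \oo _ _ (fun n => fine (P1 A1) * (1 - rho ^+ n))
  (fun n => fine (P2 A2) + sigma^-1 ^+ n)).
- have : (fun n => fine (P1 A1) * (1 - rho ^+ n)) @ \oo --> fine (P1 A1) * (1 - 0).
    apply: cvgM; [exact: cvg_cst|apply: cvgB; [exact: cvg_cst|]].
    by apply: cvg_expr; rewrite ger0_norm.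
  by rewrite subr0 mulr1.
- have : (fun n => fine (P2 A2) + sigma^-1 ^+ n) @ \oo --> fine (P2 A2) + 0.
    apply: cvgD; [exact: cvg_cst|apply: cvg_expr].
    by rewrite ger0_norm ?invr_ge0 ?(ltW sigma0)// invf_lt1.
  by rewrite addr0.
- by apply: nearW => n; rewrite (le_trans (le1 n))// p12 le2.
Qed.

(** Open right half-lines are closed under intersection and generate the Borel sets. This form also
    serves directly in [chord_law_angle], where tails are integrals over open intervals. *)
Lemma eq_tail_distribution d1 d2 (T1 : measurableType d1) (T2 : measurableType d2)
    (P1 : probability T1 R) (P2 : probability T2 R) (f1 : T1 -> R) (f2 : T2 -> R) :
  measurable_fun setT f1 -> measurable_fun setT f2 ->
  (forall x, P1 (f1 @^-1` `]x, +oo[) = P2 (f2 @^-1` `]x, +oo[)) ->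
  forall A : set R, measurable A -> P1 (f1 @^-1` A) = P2 (f2 @^-1` A).
Proof.
move=> mf1 mf2 f12 A mA.
pose g1 : {RV P1 >-> R} := HB.pack f1 (isMeasurableFun.Build _ _ _ _ f1 mf1).
pose g2 : {RV P2 >-> R} := HB.pack f2 (isMeasurableFun.Build _ _ _ _ f2 mf2).
apply: (@measure_unique _ R _ (@measurable_realfun.RGenOInfty.G R)
   (fun n => `](- n%:R), +oo[%classic) _ _ _ _ (distribution P1 g1) (distribution P2 g2)) => //.
- exact: measurable_realfun.RGenOInfty.measurableE.
- move=> _ _ [x ->] [y ->]; exists (Num.max x y).
  by apply/seteqP; split=> z /=; rewrite !in_itv/= !andbT gt_max => /andP.
- by move=> n; exists (- n%:R).
- apply/seteqP; split => // x _; exists (Num.truncn `|x|).+1 => //=.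
  rewrite in_itv/= andbT ltrNl (le_lt_trans (ler_norm _))// normrN.
  exact: truncnS_gt.
- by move=> _ [x ->]; exact: f12.
- by move=> k; rewrite (le_lt_trans (probability_le1 _ _)) ?ltry.
Qed.

Lemma eq_cdf_distribution d1 d2 (T1 : measurableType d1) (T2 : measurableType d2)
    (P1 : probability T1 R) (P2 : probability T2 R) (f1 : T1 -> R) (f2 : T2 -> R) :
  measurable_fun setT f1 -> measurable_fun setT f2 ->
  (forall x, P1 (f1 @^-1` `]-oo, x]) = P2 (f2 @^-1` `]-oo, x])) ->
  forall A : set R, measurable A -> P1 (f1 @^-1` A) = P2 (f2 @^-1` A).
Proof.
move=> mf1 mf2 f12; apply: eq_tail_distribution => // x.
have tail d (T : measurableType d) (P : probability T R) (f : T -> R) :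
    measurable_fun setT f -> P (f @^-1` `]x, +oo[) = (1 - P (f @^-1` `]-oo, x]))%E.
  move=> mf; rewrite -setCitvl preimage_setC probability_setC//.
  by have := mf measurableT _ (measurable_itv `]-oo, x]); rewrite setTI.
by rewrite !tail// f12.
Qed.

(** The gap y < z of [le_cdf_moments] is closed by letting z decrease to y, distribution functions
    being right continuous; exchanging the two laws gives equality. *)
Lemma eq_moments_distribution d1 d2 (T1 : measurableType d1) (T2 : measurableType d2)
    (P1 : probability T1 R) (P2 : probability T2 R) (f1 : T1 -> R) (f2 : T2 -> R)
    (a b : R) :
  measurable_fun setT f1 -> measurable_fun setT f2 ->
  {ae P1, forall t, a <= f1 t <= b} -> {ae P2, forall t, a <= f2 t <= b} ->
  (forall k, \int[P1]_t f1 t ^+ k = \int[P2]_t f2 t ^+ k) ->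
  forall A : set R, measurable A -> P1 (f1 @^-1` A) = P2 (f2 @^-1` A).
Proof.
have cdf_le d3 d4 (T3 : measurableType d3) (T4 : measurableType d4)
    (P3 : probability T3 R) (P4 : probability T4 R) (f3 : T3 -> R) (f4 : T4 -> R) (x : R) :
    measurable_fun setT f4 ->
    (forall z, (x < z)%R -> P3 (f3 @^-1` `]-oo, x]) <= P4 (f4 @^-1` `]-oo, z]))%E ->
    (P3 (f3 @^-1` `]-oo, x]) <= P4 (f4 @^-1` `]-oo, x]))%E.
  move=> mf4 le34.
  pose g4 : {RV P4 >-> R} := HB.pack f4 (isMeasurableFun.Build _ _ _ _ f4 mf4).
  have cvgx := @cdf_right_continuous _ _ _ P4 g4 x.
  apply: (cvge_to_ge cvgx).
  by near=> z; apply: le34; near: z; exact: nbhs_right_gt.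
move=> mf1 mf2 f1ab f2ab f12; apply: eq_cdf_distribution => // x.
apply/eqP; rewrite eq_le; apply/andP; split; apply: cdf_le => // z xz.
- exact: (le_cdf_moments _ _ f1ab f2ab).
- exact: (le_cdf_moments _ _ f2ab f1ab).
Unshelve. all: by end_near. Qed.

End moments.

(** * Moments of the uniform law on the sphere *)

Lemma eq_distribution_Rintegral (R : realType) d1 d2 (T1 : measurableType d1)
    (T2 : measurableType d2) (P1 : probability T1 R) (P2 : probability T2 R)
    (f1 : T1 -> R) (f2 : T2 -> R) (h : R -> R) :
  measurable_fun setT f1 -> measurable_fun setT f2 -> measurable_fun setT h ->
  ae_bounded P1 (h \o f1) -> ae_bounded P2 (h \o f2) ->
  (forall A : set R, measurable A -> P1 (f1 @^-1` A) = P2 (f2 @^-1` A)) ->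
  \int[P1]_t h (f1 t) = \int[P2]_t h (f2 t).
Proof.
move=> mf1 mf2 mh b1 b2 f12.
pose g1 : {RV P1 >-> R} := HB.pack f1 (isMeasurableFun.Build _ _ _ _ f1 mf1).
pose g2 : {RV P2 >-> R} := HB.pack f2 (isMeasurableFun.Build _ _ _ _ f2 mf2).
congr fine.
transitivity (\int[distribution P1 g1]_x (h x)%:E)%E.
  rewrite integral_distribution//; first exact/measurable_EFinP.
  exact: ae_bounded_integrable b1.
transitivity (\int[distribution P2 g2]_x (h x)%:E)%E.
  by apply: eq_measure_integral => A mA _; exact: f12.
rewrite integral_distribution//; first exact/measurable_EFinP.
exact: ae_bounded_integrable b2.
Qed.

(** Only the coefficients up to degree 2 matter, so the rest is hidden in [s]. The lemma is applied
    in a polynomial ring with ['X] for [x]. *)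
Lemma powS_quadratic (A : comPzRingType) (b c x : A) n : exists s,
  (1 + b * x + c * x ^+ 2) ^+ n =
  1 + (n%:R * b) * x + (n%:R * c + 'C(n, 2)%:R * b ^+ 2) * x ^+ 2 + x ^+ 3 * s.
Proof.
elim: n => [|n [s IH]]; first by exists 0; rewrite bin0n/=; ring.
exists (s * (1 + b * x + c * x ^+ 2) + n%:R * b * c +
  (n%:R * c + 'C(n, 2)%:R * b ^+ 2) * (b + c * x)).
by rewrite exprS IH binS bin1 natrD -natr1; ring.
Qed.

(** Otherwise the nonzero difference would have as many distinct roots as its size: the first
    natural numbers. *)
Lemma poly_eqP (R : numDomainType) (p q : {poly R}) :
  (forall x, p.[x] = q.[x]) -> p = q.
Proof.
move=> pq; apply/eqP; rewrite -subr_eq0; apply/negPn/negP => pq0.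
have := @max_poly_roots _ (p - q) [seq n%:R | n <- iota 0 (size (p - q))] pq0.
rewrite size_map size_iota ltnn => h.
suff : false by [].
apply: h.
  by apply/allP => x _; rewrite /root !hornerE pq subrr.
by rewrite map_inj_uniq ?iota_uniq//; apply: mulrIn; exact: oner_neq0.
Qed.

Section sphere_law.
Context d (T : measurableType d) (R : realType) (P : probability T R) (N : nat)
  (r : R) (X : {RV P >-> N.-tuple R}).
Hypotheses (r0 : 0 < r) (unifX : uniform_on_sphere r X).

(** The sphere and the whole space have the same trace on the sphere, hence the same [sphere_unif];
    the latter is 1 because the law is a probability. The quotient itself is never evaluated. *)
Lemma uniform_in_sphere : P (X @^-1` sphere N r) = 1%E.
Proof.
have mS := @measurable_sphere R N r.
change (distribution P X (sphere N r) = 1%E).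
rewrite -(probability_setT (distribution P X)).
transitivity (sphere_unif r (sphere N r)); first exact: unifX.
rewrite [RHS](unifX measurableT).
by rewrite /sphere_unif setTI setIid.
Qed.

Lemma ae_uniform_sphere : {ae P, forall t, dot (X t) (X t) = r ^+ 2}.
Proof.
have mS : measurable (X @^-1` sphere N r).
  by rewrite -[X in measurable X]setTI; apply: measurable_funPT => //; exact: measurable_sphere.
exists (~` (X @^-1` sphere N r)); split.
- exact: measurableC.
- by rewrite probability_setC// uniform_in_sphere subee.
- by move=> t /= + /sphereE; apply.
Qed.

Lemma measurable_dotr y : measurable_fun setT (fun t => dot (X t) y).
Proof. by apply: measurable_dot. Qed.

(** The reflection exchanging y and z preserves the law of X, and being self-adjoint it moves from X
    onto y, which it turns into z. *)
Lemma uniform_dot_law y z (A : set R) : dot y y = dot z z -> measurable A ->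
  P ((fun t => dot (X t) y) @^-1` A) = P ((fun t => dot (X t) z) @^-1` A).
Proof.
move=> yz mA.
have mB w : measurable ((fun x : N.-tuple R => dot x w) @^-1` A).
  have m : measurable_fun setT (fun x : N.-tuple R => dot x w) by exact: measurable_dot.
  by rewrite -[X in measurable X]setTI; exact: m.
change (distribution P X ((fun x => dot x y) @^-1` A) =
        distribution P X ((fun x => dot x z) @^-1` A)).
transitivity (sphere_unif r ((fun x => dot x y) @^-1` A)); first exact: unifX.
transitivity (sphere_unif r ((fun x => dot x z) @^-1` A)); last first.
  by apply/esym/unifX.
rewrite -(sphere_unif_isometry ((fun x => dot x y) @^-1` A)
  (@reflection_isometry R N (lincomb 1 y (-1) z))
  (@reflectionK R N (lincomb 1 y (-1) z)) (@reflection_sphere R N _ r)).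
congr (sphere_unif _ _); apply/seteqP; split => x /=;
  by rewrite dot_reflectionl reflection_swap.
Qed.

Lemma ae_bounded_tnth i : ae_bounded P (fun t => tnth (X t) i).
Proof.
split; first by have /measurable_fun_tnthP := @measurable_funPT _ _ _ _ X; exact.
exists r; apply: filterS ae_uniform_sphere => t; rewrite /dot => Xt.
rewrite -(@ler_pXn2r _ 2)// ?nnegrE ?(ltW r0)// -Xt real_normK ?num_real//.
rewrite (bigD1 i)//= -expr2 lerDl.
by apply: sumr_ge0 => j _; rewrite -expr2 sqr_ge0.
Qed.

Lemma ae_bounded_dot y : ae_bounded P (fun t => dot (X t) y).
Proof.
by apply: ae_bounded_sum => i; apply: ae_boundedM;
  [exact: ae_bounded_tnth|exact: ae_bounded_cst].
Qed.

Definition dot_moment k y := \int[P]_t dot (X t) y ^+ k.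

Lemma dot_moment_norm k y z : dot y y = dot z z -> dot_moment k y = dot_moment k z.
Proof.
move=> yz; apply: (@eq_distribution_Rintegral R _ _ _ _ P P _ _ (fun s : R => s ^+ k)).
- exact: measurable_dotr.
- exact: measurable_dotr.
- exact: exprn_measurable.
- exact/ae_boundedX/ae_bounded_dot.
- exact/ae_boundedX/ae_bounded_dot.
- by move=> A mA; exact: uniform_dot_law.
Qed.

Lemma dot_moment_scale k a y :
  dot_moment k (lincomb a y 0 y) = a ^+ k * dot_moment k y.
Proof.
rewrite /dot_moment -RintegralZl//; last first.
  by apply: ae_bounded_integrable; exact/ae_boundedX/ae_bounded_dot.
by apply: eq_Rintegral => t _; rewrite dot_lincombr mul0r addr0 exprMn.
Qed.

(** Since -y has the norm of y, an odd moment equals its own opposite. *)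
Lemma dot_moment_odd m y : dot_moment m.*2.+1 y = 0.
Proof.
have : dot_moment m.*2.+1 (lincomb (-1) y 0 y) = dot_moment m.*2.+1 y.
  by apply: dot_moment_norm; rewrite !(dot_lincombl, dot_lincombr); ring.
by rewrite dot_moment_scale -signr_odd/= odd_double/= expr1; lra.
Qed.

Lemma dot_moment_shift k y v u :
  dot_moment k (lincomb 1 y u v) = \sum_(i < k.+1) 'C(k, i)%:R *
    (\int[P]_t (dot (X t) y ^+ (k - i) * dot (X t) v ^+ i)) * u ^+ i.
Proof.
have bM i : ae_bounded P (fun t => dot (X t) y ^+ (k - i) * dot (X t) v ^+ i).
  by apply: ae_boundedM; exact/ae_boundedX/ae_bounded_dot.
transitivity (\sum_(i < k.+1) \int[P]_t ('C(k, i)%:R * u ^+ i *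
    (dot (X t) y ^+ (k - i) * dot (X t) v ^+ i))); last first.
  apply: eq_bigr => i _; rewrite RintegralZl//; last exact: ae_bounded_integrable.
  by ring.
rewrite -Rintegral_sum; last first.
  by move=> i; apply: ae_boundedM => //; exact: ae_bounded_cst.
apply: eq_Rintegral => t _; rewrite dot_lincombr mul1r exprDn.
by apply: eq_bigr => i _; rewrite exprMn -mulr_natl; ring.
Qed.

Definition unit_vector (i : 'I_N) : N.-tuple R := [tuple (j == i)%:R | j < N].

Lemma dot_unit_vector x i : dot x (unit_vector i) = tnth x i.
Proof.
rewrite /dot (bigD1 i)//= tnth_mktuple eqxx mulr1 big1 ?addr0// => j ji.
by rewrite tnth_mktuple (negbTE ji) mulr0.
Qed.

(** E <X, y + u e_i>^(2m+2) is computed twice as a polynomial in u: by the binomial formula, and as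
    the moment at y times (|y + u e_i|^2 / r^2)^(m+1) = (1 + 2 y_i u / r^2 + u^2 / r^2)^(m+1). The
    statement compares the coefficients of u^2. *)
Lemma dot_moment_coef2 m y i : dot y y = r ^+ 2 ->
  'C(m.+1.*2, 2)%:R *
    (\int[P]_t (dot (X t) y ^+ m.*2 * tnth (X t) i ^+ 2)) =
  (m.+1%:R * r ^- 2 + 'C(m.+1, 2)%:R * (2 * tnth y i * r ^- 2) ^+ 2) *
    dot_moment m.+1.*2 y.
Proof.
move=> yr; have rn0 : r != 0 by rewrite gt_eqF.
pose e := unit_vector i.
pose p := \poly_(l < m.+1.*2.+1) ('C(m.+1.*2, l)%:R *
    (\int[P]_t (dot (X t) y ^+ (m.+1.*2 - l) * dot (X t) e ^+ l))).
pose b := 2 * tnth y i * r ^- 2.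
pose q : {poly R} := (1 + b%:P * 'X + (r ^- 2)%:P * 'X ^+ 2) ^+ m.+1.
have pq : p = (dot_moment m.+1.*2 y)%:P * q.
  apply: poly_eqP => u; rewrite horner_poly -dot_moment_shift.
  have nE : dot (lincomb 1 y u e) (lincomb 1 y u e) =
      r ^+ 2 + 2 * u * tnth y i + u ^+ 2.
    rewrite !(dot_lincombl, dot_lincombr) yr (dotC e y) !dot_unit_vector.
    by rewrite tnth_mktuple eqxx/= mulr1n; ring.
  set s := r ^+ 2 + _ + _ in nE.
  have s0 : 0 <= s by rewrite -nE dot_ge0.
  (* y + u e_i may be replaced by the multiple of y of the same norm. The exponent being even, the
     square root disappears and a polynomial in u remains. *)
  rewrite (@dot_moment_norm _ _ (lincomb (Num.sqrt s / r) y 0 y)); last first.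
    rewrite nE !(dot_lincombl, dot_lincombr) yr !mul0r !addr0.
    by rewrite -[LHS](sqr_sqrtr s0); field.
  rewrite dot_moment_scale !hornerE mulrC; congr (_ * _).
  rewrite -mul2n exprM expr_div_n sqr_sqrtr//; congr (_ ^+ _).
  by rewrite /s /b/=; field.
have [s qE] := powS_quadratic b%:P (r ^- 2)%:P 'X m.+1.
have /(congr1 (fun p : {poly R} => p`_2)) := pq.
rewrite coef_poly {1}doubleS/= (_ : m.+1.*2 - 2 = m.*2)%N; last by rewrite doubleS subn2.
under eq_Rintegral do rewrite /e dot_unit_vector.
move=> ->; rewrite coefCM /q qE mulrC; congr (_ * _).
rewrite -!polyC_natr -!polyC_exp -!polyCM -!polyCD !coefD coef1/= !coefCM coefX coefXn/=.
by rewrite coefXnM/= mulr0 !add0r addr0 mulr1.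
Qed.

(** Summing [dot_moment_coef2] over i, the left side collapses by sum X_i^2 = r^2, almost surely,
    and the right side by sum y_i^2 = r^2. The right coefficient is (m + 1) (N + 2 m) / r^2, the
    left one (m + 1) (2 m + 1) r^2, and m + 1 cancels. *)
Lemma dot_momentS m y : dot y y = r ^+ 2 ->
  (N + m.*2)%:R * dot_moment m.+1.*2 y = m.*2.+1%:R * r ^+ 4 * dot_moment m.*2 y.
Proof.
move=> yr; have rn0 : r != 0 by rewrite gt_eqF.
have bX i : ae_bounded P (fun t => dot (X t) y ^+ m.*2 * tnth (X t) i ^+ 2).
  by apply: ae_boundedM; apply: ae_boundedX; [exact: ae_bounded_dot|exact: ae_bounded_tnth].
have sumX : \sum_i \int[P]_t (dot (X t) y ^+ m.*2 * tnth (X t) i ^+ 2) =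
    r ^+ 2 * dot_moment m.*2 y.
  rewrite -Rintegral_sum// /dot_moment -RintegralZl//; last first.
    by apply: ae_bounded_integrable; exact/ae_boundedX/ae_bounded_dot.
  congr fine; apply: ae_eq_integral => //.
  - by apply/measurable_EFinP; have [] := ae_bounded_sum (index_enum 'I_N) bX.
  - apply/measurable_EFinP; apply: measurable_funM => //.
    by have [] := ae_boundedX m.*2 (ae_bounded_dot y).
  - apply: filterS ae_uniform_sphere => t Xt _; congr EFin.
    rewrite -mulr_sumr mulrC -Xt; congr (_ * _).
have : \sum_(i < N) 'C(m.+1.*2, 2)%:R *
      (\int[P]_t (dot (X t) y ^+ m.*2 * tnth (X t) i ^+ 2)) =
    \sum_(i < N) (m.+1%:R * r ^- 2 + 'C(m.+1, 2)%:R * (2 * tnth y i * r ^- 2) ^+ 2) *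
      dot_moment m.+1.*2 y.
  by apply: eq_bigr => i _; exact: dot_moment_coef2.
have sumy : \sum_i (2 * tnth y i * r ^- 2) ^+ 2 = 4 * r ^- 2.
  transitivity (\sum_i 4 * r ^- 4 * (tnth y i * tnth y i)).
    by apply: eq_bigr => i _; field.
  by rewrite -mulr_sumr -/(dot y y) yr; field.
rewrite -mulr_sumr sumX -mulr_suml big_split/= sumr_const card_ord -mulr_sumr sumy.
have bin2E k : 'C(k.+1, 2)%:R = k.+1%:R * k%:R / 2 :> R.
  apply: (@mulIf _ 2); first by rewrite pnatr_eq0.
  rewrite divfK ?pnatr_eq0// -!natrM; congr _%:R.
  by apply: (etrans (bin_ffact k.+1 2)); rewrite ffactnS ffactn1.
have d0 : m.*2%:R = 2 * m%:R :> R by rewrite -mul2n natrM.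
have d1 : m.*2.+1%:R = 2 * m%:R + 1 :> R by rewrite -natr1 d0.
have d2 : m.*2.+2%:R = 2 * m%:R + 2 :> R by rewrite -natr1 d1; ring.
have m1 : m%:R + 1 != 0 :> R by rewrite natr1 pnatr_eq0.
have dm : m.+1%:R = m%:R + 1 :> R by rewrite -natr1.
rewrite doubleS !bin2E d2 d1 natrD d0 dm -[_ *+ N]mulr_natr.
set a := dot_moment _ _; set c := dot_moment _ _ => E.
apply: (mulfI m1).
transitivity (r ^+ 2 * (((m%:R + 1) * r ^- 2 * N%:R +
    (m%:R + 1) * m%:R / 2 * (4 * r ^- 2)) * c)); first by field.
by rewrite -E; field.
Qed.

End sphere_law.

Section bilinear_law.
Context d (T : measurableType d) (R : realType) (P : probability T R) (N : nat)
  (r : R) (X Y : {RV P >-> N.-tuple R}).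
Hypotheses (unifX : uniform_on_sphere r X) (unifY : uniform_on_sphere r Y)
  (indXY : independent_RV Y X).

(* By Fubini: for a fixed value of [Y] on the sphere, the law of [dot X Y] is
   that of [dot X y], whatever the point [y] of the sphere. *)
Lemma dot_independent_law y (A : set R) : dot y y = r ^+ 2 -> measurable A ->
  P ((fun t => dot (Y t) (X t)) @^-1` A) = P ((fun t => dot (X t) y) @^-1` A).
Proof.
move=> yr mA.
pose Z t := (Y t, X t).
have mZ : measurable_fun setT Z by exact: measurable_fun_pair.
pose Z' : {mfun T >-> (N.-tuple R * N.-tuple R)%type} :=
  HB.pack Z (isMeasurableFun.Build _ _ _ _ Z mZ).
pose B : set (N.-tuple R * N.-tuple R) := (fun z => dot z.1 z.2) @^-1` A.
have mB : measurable B.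
  have m : measurable_fun setT (fun z : N.-tuple R * N.-tuple R => dot z.1 z.2).
    exact: measurable_dot.
  by rewrite -[X in measurable X]setTI; exact: m.
have YXE := @product_measure_unique _ _ _ _ R (distribution P Y) (distribution P X)
  (distribution P Z').
transitivity (distribution P Z' B); first by [].
transitivity ((distribution P Y \x distribution P X)%E B).
  by apply/esym/YXE => // C D mC mD; exact: indXY.
transitivity (\int[distribution P Y]_x (distribution P X (xsection B x)))%E; first by [].
rewrite ge0_integral_distribution//; last exact: measurable_fun_xsection.
pose c := P ((fun t => dot (X t) y) @^-1` A).
transitivity (\int[P]_t c)%E; last first.
  by rewrite integral_cst//= probability_setT mule1.
apply: ae_eq_integral => //.
  by apply: measurableT_comp => //; exact: measurable_fun_xsection.
apply: filterS (ae_uniform_sphere unifY) => t Yt _ /=.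
rewrite /c -(uniform_dot_law unifX (y := Y t)) ?yr//.
congr (P _); apply/seteqP; split => w /=; rewrite /xsection/= inE /B/= dotC//.
Qed.

End bilinear_law.

(** * Integrals of powers of sine and cosine *)

Section trigonometric_moments.
Context {R : realType}.
Notation mu := lebesgue_measure.

Lemma Rintegral_FTC2 (F f : R -> R) (a b : R) : a < b -> continuous f ->
  (forall x : R, is_derive x 1 F (f x)) -> \int[mu]_(x in `[a, b]) f x = F b - F a.
Proof.
move=> ab cf dF; rewrite /Rintegral (@continuous_FTC2 _ f F)//.
- exact: continuous_subspaceT.
- have cF : continuous F.
    by move=> x; apply/differentiable_continuous/derivable1_diffP; have [] := dF x.
  split; last 2 first.
  + exact/cvg_at_right_filter/cF.
  + exact/cvg_at_left_filter/cF.
  + by move=> x _; have [] := dF x.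
- by move=> x _; rewrite derive1E; apply: derive_val.
Qed.

Lemma is_derive_exprn (f : R -> R) (x df : R) n : is_derive x 1 f df ->
  is_derive x 1 (fun y => f y ^+ n.+1) (n.+1%:R * f x ^+ n * df).
Proof.
move=> dfx; have := is_deriveX n.+1 dfx.
by rewrite (_ : f ^+ n.+1 = (fun y => f y ^+ n.+1)) //; apply/funext => y; rewrite fctE.
Qed.

Lemma continuous_trig k n : continuous (fun x : R => cos x ^+ k * sin x ^+ n).
Proof.
move=> x; apply: cvgM.
  by apply: (@continuous_comp _ _ _ cos (fun s => s ^+ k)); [exact: continuous_cos|exact: exprn_continuous].
by apply: (@continuous_comp _ _ _ sin (fun s => s ^+ n)); [exact: continuous_sin|exact: exprn_continuous].
Qed.

Definition trig_moment n k : R := \int[mu]_(x in `[0, pi]) (cos x ^+ k * sin x ^+ n).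

Lemma continuous_integrable (f : R -> R) (a b : R) :
  continuous f -> mu.-integrable `[a, b] (EFin \o f).
Proof.
move=> cf; apply: continuous_compact_integrable; first exact: segment_compact.
exact: continuous_subspaceT.
Qed.

(** Up to the factor n + 1, the integrand is the derivative of sin^(n+1), which vanishes at 0 and
    pi. *)
Lemma trig_moment1 n : trig_moment n 1 = 0.
Proof.
have : \int[mu]_(x in `[0, pi]) (n.+1%:R * (cos x ^+ 1 * sin x ^+ n)) = 0 :> R.
  transitivity (sin pi ^+ n.+1 - sin 0 ^+ n.+1 : R); last by rewrite sinpi sin0 subrr.
  apply: (@Rintegral_FTC2 (fun x => sin x ^+ n.+1)); first exact: pi_gt0.
  - by move=> x; apply: cvgM; [exact: cvg_cst|exact: continuous_trig].
  - move=> x.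
    apply: (is_derive_eq (is_derive_exprn n (is_derive_sin x))).
    by rewrite expr1; ring.
rewrite RintegralZl//; last exact/continuous_integrable/continuous_trig.
by move/eqP; rewrite mulf_eq0 pnatr_eq0/= => /eqP.
Qed.

(** The function cos^(k+1) sin^(n+1) vanishes at 0 and pi. Its derivative, once sin^2 is replaced by
    1 - cos^2, is (n + k + 2) cos^(k+2) sin^n - (k + 1) cos^k sin^n. *)
Lemma trig_momentS n k :
  (n + k).+2%:R * trig_moment n k.+2 = k.+1%:R * trig_moment n k.
Proof.
apply/eqP; rewrite -subr_eq0 -!RintegralZl//; try exact/continuous_integrable/continuous_trig.
rewrite -RintegralB//; last 2 first.
- by apply: continuous_integrable => x; apply: cvgM; [exact: cvg_cst|exact: continuous_trig].
- by apply: continuous_integrable => x; apply: cvgM; [exact: cvg_cst|exact: continuous_trig].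
apply/eqP; transitivity (cos pi ^+ k.+1 * sin pi ^+ n.+1 - cos 0 ^+ k.+1 * sin 0 ^+ n.+1 : R).
  apply: (@Rintegral_FTC2 (fun x => cos x ^+ k.+1 * sin x ^+ n.+1)); first exact: pi_gt0.
- by move=> x; apply: cvgB; (apply: cvgM; [exact: cvg_cst|exact: continuous_trig]).
- move=> x.
  apply: (is_derive_eq (is_deriveM (is_derive_exprn k (is_derive_cos x))
    (is_derive_exprn n (is_derive_sin x)))).
  rewrite /GRing.scale/= -!natr1 !natrD !exprS.
  have cs := cos2Dsin2 x.
  (* The Pythagorean identity times the cofactor by which the two sides differ, so that a ring
     identity remains. *)
  have cs0 : (k%:R + 1) * cos x ^+ k * sin x ^+ n * (1 - (cos x ^+ 2 + sin x ^+ 2)) = 0.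
    by rewrite cs subrr mulr0.
  by rewrite -[RHS]addr0 -cs0; ring.
- by rewrite sinpi sin0 !exprS !mul0r !mulr0 subrr.
Qed.

Lemma trig_moment_odd n k : trig_moment n k.*2.+1 = 0.
Proof.
elim: k => [|k IH]; first exact: trig_moment1.
have := trig_momentS n k.*2.+1; rewrite IH mulr0 => /eqP.
by rewrite mulf_eq0 pnatr_eq0/= => /eqP.
Qed.

(** The bound is a parameter because the normalization of the angle uses pi, whereas t = sin^2 x in
    the Beta integral leads to pi / 2. *)
Definition sin_integral (b : R) n : R := \int[mu]_(x in `[0, b]) sin x ^+ n.

Lemma trig_moment0 n : trig_moment n 0 = sin_integral pi n.
Proof. by apply: eq_Rintegral => x _; rewrite expr0 mul1r. Qed.

Lemma continuous_sinX n : continuous (fun x : R => sin x ^+ n).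
Proof.
rewrite (_ : (fun x : R => _) = (fun x => cos x ^+ 0 * sin x ^+ n)).
  exact: continuous_trig.
by apply/funext => x; rewrite expr0 mul1r.
Qed.

Lemma sin_integral0 (b : R) : 0 < b -> sin_integral b 0 = b.
Proof.
move=> b0; rewrite -[RHS]subr0.
by apply: (@Rintegral_FTC2 id) => // x; exact: cvg_cst.
Qed.

Lemma sin_integral1 (b : R) : 0 < b -> sin_integral b 1 = 1 - cos b.
Proof.
move=> b0; transitivity (- cos b - - cos 0 : R); last by rewrite cos0; ring.
apply: (@Rintegral_FTC2 (fun x => - cos x)) => //; first exact: continuous_sinX.
by move=> x; apply: is_derive_eq; rewrite opprK.
Qed.

(** Integration of the derivative of cos sin^(n+1). The condition on b kills the boundary term, and
    covers both b = pi and b = pi / 2. *)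
Lemma sin_integralSS (b : R) n : 0 < b -> cos b * sin b = 0 ->
  n.+2%:R * sin_integral b n.+2 = n.+1%:R * sin_integral b n.
Proof.
move=> b0 csb; have isin k := continuous_integrable 0 b (@continuous_sinX k).
have csin (c : R) k : continuous (fun x : R => c * sin x ^+ k).
  by move=> x; apply: cvgM; [exact: cvg_cst|exact: continuous_sinX].
apply/esym/eqP; rewrite -subr_eq0 -!RintegralZl//.
rewrite -RintegralB//; [|exact/continuous_integrable/csin..].
apply/eqP; transitivity (cos b * sin b ^+ n.+1 - cos 0 * sin 0 ^+ n.+1 : R); last first.
  by rewrite sin0 !exprS mulrA csb !mul0r mulr0 subrr.
apply: (@Rintegral_FTC2 (fun x => cos x * sin x ^+ n.+1)) => //.
  by move=> x; apply: cvgB; exact: csin.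
move=> x; apply: (is_derive_eq (is_deriveM (is_derive_cos x)
    (is_derive_exprn n (is_derive_sin x)))).
rewrite /GRing.scale/= -!natr1 !exprS.
have cs := cos2Dsin2 x.
have cs0 : (n%:R + 1) * sin x ^+ n * (1 - (cos x ^+ 2 + sin x ^+ 2)) = 0.
  by rewrite cs subrr mulr0.
by rewrite -[LHS]addr0 -cs0; ring.
Qed.

Lemma nat_ind2 (Q : nat -> Prop) :
  Q 0%N -> Q 1%N -> (forall n, Q n -> Q n.+2) -> forall n, Q n.
Proof.
by move=> Q0 Q1 QSS n; have [] : Q n /\ Q n.+1 by elim: n => [|n [? ?]]; split=> //; exact: QSS.
Qed.

Lemma sin_integral_gt0 n : 0 < sin_integral pi n.
Proof.
elim/nat_ind2: n => [||n IH].
- by rewrite sin_integral0 ?pi_gt0.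
- by rewrite sin_integral1 ?pi_gt0// cospi; lra.
- rewrite -(pmulr_rgt0 _ (ltr0Sn _ n.+1)) sin_integralSS ?pi_gt0 ?sinpi ?mulr0//.
  by rewrite mulr_gt0.
Qed.

(** Both sides obey the recursion [sin_integralSS], so the cases n = 0 and n = 1 decide. *)
Lemma sin_integral_half n : sin_integral pi n = 2 * sin_integral (pi / 2) n.
Proof.
have p0 := @pi_gt0 R; have h0 : 0 < pi / 2 :> R by rewrite divr_gt0.
elim/nat_ind2: n => [||n IH].
- by rewrite !sin_integral0//; field.
- by rewrite !sin_integral1// cospi cos_pihalf; ring.
- apply: (@mulfI _ n.+2%:R); first by rewrite pnatr_eq0.
  rewrite mulrCA !sin_integralSS// ?sinpi ?mulr0 ?cos_pihalf ?mul0r// IH.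
  by ring.
Qed.

End trigonometric_moments.

(** * Substitution on open intervals *)

Section substitution.
Context {R : realType}.
Notation mu := (@lebesgue_measure R).

Lemma itvoo_bigcup (a b : R) (u v : R^nat) :
  (forall n, a < u n) -> (forall n, v n < b) -> u @ \oo --> a -> v @ \oo --> b ->
  \bigcup_n `[u n, v n]%classic = `]a, b[%classic.
Proof.
move=> au vb ua vb'; apply/seteqP; split => x.
  by move=> [n _] /=; rewrite !in_itv/= => /andP[? ?]; rewrite (lt_le_trans (au n))// (le_lt_trans _ (vb n)).
rewrite /= in_itv/= => /andP[ax xb].
have : \forall n \near \oo, u n <= x /\ x <= v n.
  near=> n; split; apply/ltW.
    by near: n; exact: (cvgr_lt a).
  by near: n; exact: (cvgr_gt b).
move=> [n _ /(_ n)] /= -[//|? ?].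
by exists n => //=; rewrite in_itv/=; apply/andP.
Unshelve. all: by end_near. Qed.

(** [f] may blow up at the ends. The usual substitution holds on the closed intervals [u_n, v_n],
    and monotone convergence carries both sides to the open interval. *)
Lemma ge0_substitution_itvoo (F F' f : R -> R) (a b : R) : a < b ->
  (forall x : R, is_derive x 1 F (F' x)) -> continuous F' ->
  {in `[a, b] &, {homo F : x y / x < y}} ->
  (forall x, x \in `]F a, F b[ -> {for x, continuous f}) ->
  (forall x, x \in `]F a, F b[ -> 0 <= f x) ->
  (forall x, x \in `]a, b[ -> 0 <= F' x) ->
  (\int[mu]_(x in `]F a, F b[) (f x)%:E =
   \int[mu]_(x in `]a, b[) (f (F x) * F' x)%:E)%E.
Proof.
move=> ab dF cF' incF cf f0 F'0.
have cF : continuous F.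
  by move=> x; apply/differentiable_continuous/derivable1_diffP; have [] := dF x.
(* The factor 1 / 2 gives u_n <= v_n for every n, with equality at the midpoint for n = 0. *)
pose e n : R := (b - a) / 2 * n.+1%:R^-1.
have e0 n : 0 < e n by rewrite mulr_gt0 ?divr_gt0 ?subr_gt0// invr_gt0.
have e1 n : e n <= (b - a) / 2.
  by rewrite ler_piMr ?divr_ge0 ?subr_ge0 ?(ltW ab)// invf_le1// ler1n.
have cve : e @ \oo --> 0.
  have : (fun n => (b - a) / 2 * n.+1%:R^-1) @ \oo --> (b - a) / 2 * 0.
    by apply: cvgM; [exact: cvg_cst|exact: cvg_harmonic].
  by rewrite mulr0.
have ade m n : (m <= n)%N -> e n <= e m.
  move=> mn; rewrite ler_wpM2l ?divr_ge0 ?subr_ge0 ?(ltW ab)//.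
  by rewrite lef_pV2 ?posrE// ler_nat.
pose u n := a + e n; pose v n := b - e n.
have au n : a < u n by rewrite ltrDl.
have vb n : v n < b by rewrite gtrDl oppr_lt0.
have uv n : u n <= v n by have := e1 n; rewrite /u /v; lra.
have cu : u @ \oo --> a.
  by rewrite -[X in _ --> X]addr0; apply: cvgD => //; exact: cvg_cst.
have cv : v @ \oo --> b.
  by rewrite -[X in _ --> X]subr0; apply: cvgB => //; exact: cvg_cst.
have uab n : u n \in `[a, b] by rewrite in_itv/= (ltW (au n)) (le_trans (uv n)) ?ltW.
have vab n : v n \in `[a, b] by rewrite in_itv/= (ltW (vb n)) (le_trans _ (uv n)) ?ltW.
have aab : a \in `[a, b] by rewrite in_itv/= lexx ltW.
have bab : b \in `[a, b] by rewrite in_itv/= lexx ltW.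
have Uab := itvoo_bigcup au vb cu cv.
have UFab : \bigcup_n `[F (u n), F (v n)]%classic = `]F a, F b[%classic.
  apply: itvoo_bigcup.
  - by move=> n; apply: incF.
  - by move=> n; apply: incF.
  - by apply: continuous_cvg => //; exact: cF.
  - by apply: continuous_cvg => //; exact: cF.
have inF x : x \in `]a, b[ -> F x \in `]F a, F b[.
  rewrite !in_itv/= => /andP[ax xb].
  by rewrite !incF// in_itv/= ?ax ?xb ?ltW.
have subF n x : x \in `[F (u n), F (v n)] -> x \in `]F a, F b[.
  rewrite !in_itv/= => /andP[ux xv].
  by rewrite (lt_le_trans _ ux) ?(le_lt_trans xv)// incF.
have sub n x : x \in `[u n, v n] -> x \in `]a, b[.
  rewrite !in_itv/= => /andP[ux xv].
  by rewrite (lt_le_trans _ ux) ?(le_lt_trans xv).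
have cfF x : x \in `]a, b[ -> {for x, continuous (fun x => f (F x) * F' x)}.
  move=> xab; apply: cvgM; last exact: cF'.
  by apply: continuous_comp; [exact: cF|exact/cf/inF].
have cvl : (\int[mu]_(x in `[F (u n), F (v n)]) (f x)%:E @[n --> \oo] -->
    \int[mu]_(x in `]F a, F b[) (f x)%:E)%E.
  rewrite -UFab; apply: ge0_nondecreasing_set_cvg_integral.
  - move=> m n mn; apply/subsetPset => x /=; rewrite !in_itv/= => /andP[ux xv].
    have Fle p q : p \in `[a, b] -> q \in `[a, b] -> p <= q -> F p <= F q.
      move=> pab qab; rewrite le_eqVlt => /predU1P[->//|pq].
      by rewrite ltW// incF.
    rewrite (le_trans _ ux) ?(le_trans xv)//; apply: Fle => //.
    + by rewrite /v lerD2l lerN2 ade.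
    + by rewrite /u lerD2l ade.
  - by move=> n; exact: measurable_itv.
  - move=> n; apply/measurable_EFinP.
    apply: subspace_continuous_measurable_fun => //.
    by apply: continuous_in_subspaceT => x /[!inE] /subF; exact: cf.
  - by move=> n x /subF; rewrite lee_fin; exact: f0.
have cvr : (\int[mu]_(x in `[u n, v n]) (f (F x) * F' x)%:E @[n --> \oo] -->
    \int[mu]_(x in `]a, b[) (f (F x) * F' x)%:E)%E.
  rewrite -Uab; apply: ge0_nondecreasing_set_cvg_integral.
  - move=> m n mn; apply/subsetPset => x /=; rewrite !in_itv/= => /andP[ux xv].
    rewrite (le_trans _ ux) ?(le_trans xv)//.
    + by rewrite /v lerD2l lerN2 ade.
    + by rewrite /u lerD2l ade.
  - by move=> n; exact: measurable_itv.
  - move=> n; apply/measurable_EFinP.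
    apply: subspace_continuous_measurable_fun => //.
    by apply: continuous_in_subspaceT => x /[!inE] /sub; exact: cfF.
  - move=> n x /sub xab; rewrite lee_fin mulr_ge0//; first exact/f0/inF.
    exact: F'0.
suff eqn n : (\int[mu]_(x in `[F (u n), F (v n)]) (f x)%:E =
    \int[mu]_(x in `[u n, v n]) (f (F x) * F' x)%:E)%E.
  by rewrite (funext eqn) in cvl; exact: (cvg_unique _ cvl cvr).
have F'E : derive1 F = F' by apply/funext => x; rewrite derive1E; apply: derive_val.
rewrite (@integration_by_substitution_increasing _ F f)//.
- by apply: eq_integral => x _; rewrite F'E.
- move=> x y xuv yuv; apply: incF; apply: subset_itv_oo_cc; exact: (sub n).
- by move=> x _; rewrite F'E; exact: cF'.
- by rewrite F'E; apply/cvg_ex; exists (F' (u n)); apply/cvg_at_right_filter/cF'.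
- by rewrite F'E; apply/cvg_ex; exists (F' (v n)); apply/cvg_at_left_filter/cF'.
- split; last 2 first.
  + exact/cvg_at_right_filter/cF.
  + exact/cvg_at_left_filter/cF.
  + by move=> x _; have [] := dF x.
- by apply: continuous_in_subspaceT => x /[!inE] /subF; exact: cf.
Qed.

End substitution.

(** * Measures defined by a density *)

Section probability_density.
Context d (T : measurableType d) (R : realType) (mu : {measure set T -> \bar R})
  (f : T -> R).

(** The three proofs are arguments so that the measure and probability structures can be attached to
    this constant. *)
Definition density (mf : measurable_fun setT f) (f0 : forall x, 0 <= f x)
    (f1 : (\int[mu]_x (f x)%:E = 1)%E) : set T -> \bar R :=
  fun A => (\int[mu]_(x in A) (f x)%:E)%E.

Hypotheses (mf : measurable_fun setT f) (f0 : forall x, 0 <= f x)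
  (f1 : (\int[mu]_x (f x)%:E = 1)%E).
Local Notation dens := (density mf f0 f1).

Let density0 : dens set0 = 0%E.
Proof. exact: integral_set0. Qed.

Let density_ge0 A : (0 <= dens A)%E.
Proof. by apply: integral_ge0 => x _; rewrite lee_fin. Qed.

Let density_sigma_additive : semi_sigma_additive dens.
Proof.
move=> /= F mF tF mUF; rewrite /density; apply: cvg_toP.
  apply: ereal_nondecreasing_is_cvgn => m n mn.
  by apply: lee_sum_nneg_natr => // k _ _; exact: density_ge0.
rewrite ge0_integral_bigcup//=.
- exact/measurable_EFinP/measurable_funTS.
- by move=> x _; rewrite lee_fin.
Qed.

HB.instance Definition _ := isMeasure.Build _ _ _ dens
  density0 density_ge0 density_sigma_additive.

Let density_setT : dens setT = 1%E.
Proof. exact: f1. Qed.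

HB.instance Definition _ := @Measure_isProbability.Build _ _ R dens density_setT.

Import HBNNSimple.

Let integral_density_nnsfun (g : {nnsfun T >-> R}) :
  (\int[dens]_x (g x)%:E = \int[mu]_x (g x * f x)%:E)%E.
Proof.
have gf0 r x : (0 <= (r * \1_(g @^-1` [set r]) x * f x)%:E)%E.
  by rewrite lee_fin mulr_ge0// -lee_fin EFinM nnfun_muleindic_ge0.
rewrite integralT_nnsfun sintegralE.
under [RHS]eq_integral.
  move=> x _; rewrite EFinM fimfunE -fsumEFin// ge0_mule_fsuml; last first.
    by move=> r; rewrite EFinM nnfun_muleindic_ge0.
  under eq_fsbigr do rewrite -EFinM.
  over.
rewrite [RHS]ge0_integral_fsum//; last first.
  move=> r; apply/measurable_EFinP; apply: measurable_funM => //.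
  by apply: measurable_funM => //; exact: measurable_indic.
apply: eq_fsbigr => r; rewrite inE => -[y _ gy].
have r0 : 0 <= r by rewrite -gy.
rewrite [X in (_ * X)%E]integral_mkcond.
rewrite -ge0_integralZl//; last 2 first.
- apply: (measurable_restrictT (EFin \o f) _).1 => //.
  exact/measurable_EFinP/measurable_funTS.
- by move=> x _; rewrite patchE; case: ifP => // _; rewrite lee_fin.
apply: eq_integral => x _; rewrite patchE indicE.
case: (x \in _); first by rewrite mulr1.
by rewrite mulr0 mul0r mule0.
Qed.

(** The identity for simple functions passes to increasing limits by monotone convergence on both
    sides. *)
Lemma integral_density (g : T -> R) : measurable_fun setT g ->
  (forall x, 0 <= g x) -> (\int[dens]_x (g x)%:E = \int[mu]_x (g x * f x)%:E)%E.
Proof.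
move=> mg g0.
have mEg : measurable_fun setT (EFin \o g) by exact/measurable_EFinP.
pose g_ := nnsfun_approx measurableT mEg.
have ndg x : {homo (fun n => g_ n x) : m n / (m <= n)%N >-> m <= n}.
  by move=> m n mn; exact/lefP/nd_nnsfun_approx.
have cvg_g x : (g_ n x)%:E @[n --> \oo] --> (g x)%:E.
  by apply: (cvg_nnsfun_approx measurableT mEg) => //= y _; rewrite lee_fin.
transitivity (lim (\int[dens]_x (g_ n x)%:E @[n --> \oo])%E).
  rewrite -monotone_convergence//=.
  - by apply: eq_integral => x _; apply/esym/cvg_lim.
  - by move=> n; exact/measurable_EFinP.
  - by move=> n x _; rewrite lee_fin.
  - by move=> x _ m n mn; rewrite lee_fin ndg.
transitivity (lim (\int[mu]_x (g_ n x * f x)%:E @[n --> \oo])%E).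
  by apply: congr_lim; apply/funext => n; exact: integral_density_nnsfun.
rewrite -monotone_convergence//=.
- apply: eq_integral => x _; apply/cvg_lim => //.
  under eq_fun do rewrite EFinM.
  by rewrite EFinM; apply: cvgeZr.
- by move=> n; apply/measurable_EFinP; exact: measurable_funM.
- by move=> n x _; rewrite lee_fin mulr_ge0.
- by move=> x _ m n mn; rewrite lee_fin ler_wpM2r// ndg.
Qed.

End probability_density.

(** * The laws of the angle and of the chord length *)

Section beta_sine.
Context {R : realType}.
Notation mu := (@lebesgue_measure R).

Lemma continuous_powR_gt0 (p x : R) : 0 < x -> {for x, continuous (@powR R ^~ p)}.
Proof.
move=> x0; have [dp _] := is_derive1_powR p x0.
exact/differentiable_continuous/derivable1_diffP.
Qed.

(** Put t = sin^2 x, dt = 2 sin x cos x dx: the factor (1 - t)^(-1/2) cancels the cosine, leaving 2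
    sin^n on ]0, pi / 2[, and [sin_integral_half] absorbs the 2. *)
Lemma Beta_sin_integral n : Beta (n.+1%:R / 2) (1 / 2) = sin_integral pi n :> R.
Proof.
pose f t : R := t `^ (n.+1%:R / 2 - 1) * (1 - t) `^ (1 / 2 - 1).
have mf : measurable_fun setT f.
  apply: measurable_funM; first exact: measurable_powR.
  apply: (measurableT_comp (measurable_powR _)).
  exact: measurable_funB.
have h0 : 0 < pi / 2 :> R by rewrite divr_gt0 ?pi_gt0.
have sE : sin (0 : R) ^+ 2 = 0 by rewrite sin0 expr0n.
have sE' : sin (pi / 2 : R) ^+ 2 = 1 by rewrite sin_pihalf expr1n.
have dsin2 (x : R) : is_derive x 1 (fun y => sin y ^+ 2) (2 * (cos x ^+ 1 * sin x ^+ 1)).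
  by apply: (is_derive_eq (is_derive_exprn 1 (is_derive_sin x))); rewrite !expr1; ring.
have sub : (\int[mu]_(t in `]0%R, 1%R[) (f t)%:E =
    \int[mu]_(x in `]0%R, (pi / 2)%R[) (2 * sin x ^+ n)%:E)%E.
  have := @ge0_substitution_itvoo R (fun x => sin x ^+ 2)
    (fun x => 2 * (cos x ^+ 1 * sin x ^+ 1)) f 0 (pi / 2) h0 dsin2.
  rewrite /= sE sE' => ->.
  - apply: eq_integral => x; rewrite inE/= in_itv/= => /andP[x0 xh]; congr EFin.
    have s0 : 0 < sin x by rewrite sin_gt0_pihalf// x0.
    have c0 : 0 < cos x by rewrite cos_gt0_pihalf// xh (lt_trans _ x0)// oppr_lt0.
    have s0' := ltW s0; have c0' := ltW c0.
    have -> : f (sin x ^+ 2) = sin x `^ (n.+1%:R - 2) * (cos x)^-1.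
      rewrite /f (_ : 1 - sin x ^+ 2 = cos x ^+ 2); last by rewrite -(cos2Dsin2 x); ring.
      have pw (y p : R) : 0 <= y -> (y ^+ 2) `^ p = y `^ (2 * p).
        by move=> y0; rewrite -powR_mulrn// -powRrM.
      by rewrite !pw// -[(cos x)^-1]powR_inv1//; congr (_ `^ _ * _ `^ _); field.
    transitivity (2 * (sin x `^ (n.+1%:R - 2) * sin x `^ 1)).
      by rewrite powRr1// !expr1; field; rewrite gt_eqF.
    rewrite -powRD; last by apply/implyP => _; rewrite gt_eqF.
    rewrite -powR_mulrn//; congr (_ * _ `^ _).
    by rewrite -natr1; ring.
  - by move=> x; apply: cvgM; [exact: cvg_cst|exact: continuous_trig].
  - move=> x y; rewrite !in_itv/= => /andP[x0 xh] /andP[y0 yh] xy.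
    have hpi : pi / 2 <= pi :> R by rewrite ler_pdivrMr// ler_peMr ?ltW ?pi_gt0// ltr1n.
    have sge0 (z : R) : 0 <= z -> z <= pi / 2 -> 0 <= sin z.
      by move=> z0 zh; rewrite sin_ge0_pi// z0 (le_trans zh hpi).
    rewrite ltr_pXn2r// ?nnegrE ?sge0// ltr_sin// in_itv/= ?xh ?yh andbT.
      by rewrite (le_trans _ x0)// oppr_le0 ltW.
    by rewrite (le_trans _ y0)// oppr_le0 ltW.
  - move=> t; rewrite in_itv/= => /andP[t0 t1].
    apply: cvgM; first exact: continuous_powR_gt0.
    apply: (@continuous_comp R R R (fun t : R => 1 - t) (@powR R ^~ (1 / 2 - 1))).
      by apply: cvgB; [exact: cvg_cst|exact: cvg_id].
    by apply: continuous_powR_gt0; rewrite subr_gt0.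
  - by move=> t _; rewrite /f mulr_ge0// powR_ge0.
  - move=> x; rewrite in_itv/= => /andP[x0 xh]; rewrite !expr1.
    have s0 : 0 < sin x by rewrite sin_gt0_pihalf// x0.
    have c0 : 0 < cos x by rewrite cos_gt0_pihalf// xh (lt_trans _ x0)// oppr_lt0.
    by rewrite !mulr_ge0// ltW.
rewrite sin_integral_half /sin_integral -RintegralZl//; last first.
  exact/continuous_integrable/continuous_sinX.
rewrite /Beta /Rintegral; congr fine.
have m2 : measurable_fun setT (fun x : R => 2 * sin x ^+ n).
  apply: continuous_measurable_fun => x.
  by apply: cvgM; [exact: cvg_cst|exact: continuous_sinX].
have mEf (A : set R) : measurable_fun A (EFin \o f).
  by apply/measurable_EFinP; exact: measurable_funTS mf.
have mE2 (A : set R) : measurable_fun A (EFin \o (fun x : R => 2 * sin x ^+ n)).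
  by apply/measurable_EFinP; exact: measurable_funTS m2.
transitivity (\int[mu]_(t in `]0%R, 1%R[) (f t)%:E)%E.
  exact: (integral_itv_bndoo true false (mEf _)).
by rewrite sub; apply/esym; exact: (integral_itv_bndoo true false (mE2 _)).
Qed.

End beta_sine.

Section angle_law.
Context {R : realType} (n : nat).
Notation mu := (@lebesgue_measure R).

Definition angle_pdf (x : R) : R := \1_(`]0, pi[) x * (sin x ^+ n / sin_integral pi n).

Lemma measurable_sin_pdf : measurable_fun setT (fun x : R => sin x ^+ n / sin_integral pi n).
Proof.
apply: measurable_funM => //; apply: continuous_measurable_fun.
exact: continuous_sinX.
Qed.

Lemma measurable_angle_pdf : measurable_fun setT angle_pdf.
Proof. by apply: measurable_funM => //; exact: measurable_sin_pdf. Qed.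

Lemma angle_pdf_ge0 x : 0 <= angle_pdf x.
Proof.
rewrite /angle_pdf indicE; have [|] := boolP (x \in _); last by rewrite mul0r.
rewrite inE/= in_itv/= mul1r => x0pi; rewrite divr_ge0 ?exprn_ge0 ?ltW//.
  exact: sin_gt0_pi.
exact: sin_integral_gt0.
Qed.

Lemma integral_angle_pdfM (g : R -> R) (A : set R) :
  (\int[mu]_(x in A) (g x * angle_pdf x)%:E =
   \int[mu]_(x in A `&` `]0%R, pi[) (g x * (sin x ^+ n / sin_integral pi n))%:E)%E.
Proof.
rewrite [RHS]integral_mkcondr; apply: eq_integral => x _.
rewrite patchE /angle_pdf indicE; case: (x \in _); first by rewrite mul1r.
by rewrite mul0r mulr0.
Qed.

Lemma integral_angle_pdfE (A : set R) :
  (\int[mu]_(x in A) (angle_pdf x)%:E =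
   \int[mu]_(x in A `&` `]0%R, pi[) (sin x ^+ n / sin_integral pi n)%:E)%E.
Proof.
transitivity (\int[mu]_(x in A) (cst 1 x * angle_pdf x)%:E)%E.
  by apply: eq_integral => x _; rewrite mul1r.
by rewrite integral_angle_pdfM; apply: eq_integral => x _; rewrite mul1r.
Qed.

Lemma fine_integral_sin (g : R -> R) (a b : R) : continuous g ->
  (\int[mu]_(x in `]a, b[) (g x * (sin x ^+ n / sin_integral pi n))%:E =
   (\int[mu]_(x in `[a, b]) (g x * sin x ^+ n) / sin_integral pi n)%:E)%E.
Proof.
move=> cg; set W := sin_integral _ _.
have cgs : continuous (fun x : R => W^-1 * (g x * sin x ^+ n)).
  move=> x; apply: cvgM; first exact: cvg_cst.
  by apply: cvgM; [exact: cg|exact: continuous_sinX].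
have cgs1 : continuous (fun x : R => g x * sin x ^+ n).
  by move=> x; apply: cvgM; [exact: cg|exact: continuous_sinX].
rewrite mulrC -RintegralZl//; last exact: continuous_integrable.
rewrite /Rintegral fineK; last first.
  by apply: integrable_fin_num => //; exact: continuous_integrable.
rewrite [RHS]integral_itv_bndoo; last first.
  apply/measurable_EFinP; apply: measurable_funTS; exact: continuous_measurable_fun.
by apply: eq_integral => x _; congr EFin; rewrite /W; ring.
Qed.

Lemma integral_angle_pdf : (\int[mu]_x (angle_pdf x)%:E = 1)%E.
Proof.
transitivity (\int[mu]_(x in setT) (1 * angle_pdf x)%:E)%E.
  by apply: eq_integral => x _; rewrite mul1r.
rewrite (integral_angle_pdfM (cst 1)) setTI (@fine_integral_sin (cst 1)); last by move=> x; exact: cvg_cst.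
have -> : \int[mu]_(x in `[0, pi]) (cst 1 x * sin x ^+ n) = sin_integral pi n.
  by apply: eq_Rintegral => x _; rewrite mul1r.
by rewrite divff// gt_eqF// sin_integral_gt0.
Qed.

Definition angle_law := @density _ (measurableTypeR R) R mu angle_pdf measurable_angle_pdf angle_pdf_ge0 integral_angle_pdf.

HB.instance Definition _ := Probability.on angle_law.

(** [integral_density] is for nonnegative functions, so it is applied to cos^k + 1, and the
    contribution 1 of the constant is removed afterwards. *)
Lemma angle_law_cosX k :
  \int[angle_law]_x cos x ^+ k = trig_moment n k / sin_integral pi n.
Proof.
have W0 := @sin_integral_gt0 R n.
have ccosX : continuous (fun x : R => cos x ^+ k).
  move=> x; apply: (@continuous_comp _ _ _ cos (fun s => s ^+ k)).
    exact: continuous_cos.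
  exact: exprn_continuous.
have cosX1 x : `|cos x ^+ k| <= 1 :> R.
  by rewrite normrX exprn_ile1// ler_norml cos_geN1 cos_le1.
have bcos : ae_bounded angle_law (fun x : R => cos x ^+ k).
  split; first exact: continuous_measurable_fun.
  by exists 1; apply: aeW.
have ccos1 : continuous (fun x : R => cos x ^+ k + 1).
  by move=> x; apply: cvgD; [exact: ccosX|exact: cvg_cst].
have : \int[angle_law]_x (cos x ^+ k + 1) = trig_moment n k / sin_integral pi n + 1.
  rewrite /Rintegral integral_density//.
  - rewrite integral_angle_pdfM setTI fine_integral_sin//=.
    rewrite -[X in _ = _ + X](divff (negbT (gt_eqF W0))) -mulrDl; congr (_ / _).
    rewrite -RintegralD//; try exact/continuous_integrable/continuous_trig.
    + by apply: eq_Rintegral => x _; rewrite mulrDl mul1r.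
    + exact/continuous_integrable/continuous_sinX.
  - exact: continuous_measurable_fun.
  - by move=> x; have := cosX1 x; rewrite ler_norml => /andP[]; lra.
rewrite RintegralD//; last 2 first.
- exact: ae_bounded_integrable.
- by apply: ae_bounded_integrable; exact: ae_bounded_cst.
rewrite Rintegral_cst// mul1r (_ : fine _ = 1); last by rewrite /= /angle_law /density integral_angle_pdf.
exact: addIr.
Qed.

Lemma ae_angle_law : {ae angle_law, forall x, x \in `]0, pi[}.
Proof.
have h : angle_law `]0, pi[%classic = 1%E.
  rewrite -[RHS]integral_angle_pdf /angle_law /density !integral_angle_pdfE.
  by rewrite setIid setTI.
exists (~` `]0, pi[%classic); split; first exact: measurableC.
  rewrite probability_setC//; transitivity (1 - 1 : \bar R)%E; last exact: subee.
  by congr (1 - _)%E; exact: h.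
by move=> x /=.
Qed.

End angle_law.

(** * The chord density as the image of the angle law *)

Section chord_law.
Context {R : realType} (n : nat) (r : R).
Hypothesis r0 : 0 < r.
Notation mu := (@lebesgue_measure R).

Definition chord_of_angle (x : R) : R := 2 * r * sin (x / 2).

(** The expression of [chord_pdf] in dimension n + 2 without the restriction to ]0, 2r[, the Beta
    value being replaced by the sine integral. *)
Definition chord_formula (x : R) : R :=
  x / (r ^+ 2 * sin_integral pi n) *
  (x ^+ 2 / r ^+ 2 - x ^+ 4 / (4 * r ^+ 4)) `^ ((n.+2%:R - 3) / 2).

Lemma chord_pdfE x : chord_pdf n.+2 r x = \1_(`]0, (2 * r)[) x * chord_formula x.
Proof.
have BE : Beta ((n.+2%:R - 1) / 2) (1 / 2) = sin_integral pi n :> R.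
  have E : (n.+2%:R - 1) / 2 = n.+1%:R / 2 :> R by rewrite -[n.+2%:R]natr1 addrK.
  by rewrite E; exact: Beta_sin_integral.
rewrite /chord_pdf BE indicE mem_setE in_itv/=; case: ifP => _; last by rewrite mul0r.
by rewrite mul1r.
Qed.

Lemma measurable_chord_formula : measurable_fun setT chord_formula.
Proof.
apply: measurable_funM; first exact: measurable_funM.
apply: (measurableT_comp (measurable_powR _)).
by apply: measurable_funB; apply: measurable_funM => //; exact: exprn_measurable.
Qed.

Lemma measurable_chord_pdf : measurable_fun setT (chord_pdf n.+2 r).
Proof.
rewrite (funext chord_pdfE); apply: measurable_funM => //.
exact: measurable_chord_formula.
Qed.

Lemma chord_formula_ge0 x : 0 <= x -> 0 <= chord_formula x.
Proof.
move=> x0; rewrite mulr_ge0 ?powR_ge0// divr_ge0// mulr_ge0 ?sqr_ge0// ltW//.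
exact: sin_integral_gt0.
Qed.

Lemma chord_pdf_ge0 x : 0 <= chord_pdf n.+2 r x.
Proof.
rewrite chord_pdfE indicE mem_setE in_itv/=.
have [/andP[x0 _]|_] := boolP (_ && _); last by rewrite mul0r.
by rewrite mul1r chord_formula_ge0// ltW.
Qed.

Lemma integral_chord_pdf (A : set R) :
  (\int[mu]_(x in A) (chord_pdf n.+2 r x)%:E =
   \int[mu]_(x in A `&` `]0%R, (2 * r)%R[) (chord_formula x)%:E)%E.
Proof.
rewrite [RHS]integral_mkcondr; apply: eq_integral => x _.
by rewrite patchE chord_pdfE indicE; case: (x \in _); rewrite ?mul1r ?mul0r.
Qed.

Lemma chord_of_angle_incr : {in `[0, pi] &, {homo chord_of_angle : x y / x < y}}.
Proof.
move=> x y; rewrite !in_itv/= => /andP[x0 xp] /andP[y0 yp] xy.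
rewrite ltr_pM2l ?mulr_gt0// ltr_sin ?ltr_pM2r//.
- by rewrite in_itv/= ler_pM2r// xp andbT (@le_trans _ _ 0) ?oppr_le0 ?divr_ge0 ?pi_ge0.
- by rewrite in_itv/= ler_pM2r// yp andbT (@le_trans _ _ 0) ?oppr_le0 ?divr_ge0 ?pi_ge0.
Qed.

Lemma chord_of_angle0 : chord_of_angle 0 = 0.
Proof. by rewrite /chord_of_angle mul0r sin0 mulr0. Qed.

Lemma chord_of_anglepi : chord_of_angle pi = 2 * r.
Proof. by rewrite /chord_of_angle sin_pihalf mulr1. Qed.

Lemma is_derive_chord_of_angle (x : R) : is_derive x 1 chord_of_angle (r * cos (x / 2)).
Proof.
have dhalf : is_derive x 1 (fun y : R => y * 2^-1) (2^-1 : R).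
  apply: (is_derive_eq (is_deriveM (is_derive_id x 1) (is_derive_cst (2^-1 : R) x 1))).
  by rewrite /GRing.scale/=; ring.
have dsin := @is_derive1_comp R sin (fun y : R => y * 2^-1) x _ _ (is_derive_sin _) dhalf.
apply: (is_derive_eq (is_deriveZ (2 * r) dsin)).
by rewrite /GRing.scale/=; field.
Qed.

Lemma continuous_chord_of_angle : continuous chord_of_angle.
Proof.
move=> x; apply/differentiable_continuous/derivable1_diffP.
by have [] := is_derive_chord_of_angle x.
Qed.

(** For d = 2 r sin (x / 2), the base d^2 / r^2 - d^4 / (4 r^4) is 4 sin^2 (x / 2) cos^2 (x / 2) =
    sin^2 x, whose power is sin^(n-1) x; the missing sine comes from d d' = r^2 sin x. *)
Lemma chord_formula_angle x : 0 < x < pi ->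
  chord_formula (chord_of_angle x) * (r * cos (x / 2)) = sin x ^+ n / sin_integral pi n.
Proof.
move=> /andP[x0 xp]; have W0 := @sin_integral_gt0 R n.
have s0 : 0 < sin x by rewrite sin_gt0_pi// x0.
have rn0 := gt_eqF r0.
have sE : sin x = 2 * cos (x / 2) * sin (x / 2).
  have -> : sin x = sin (x / 2 *+ 2) by congr sin; rewrite -mulr_natr; field.
  by rewrite sin_mulr2n -mulr_natr; ring.
have hE : chord_of_angle x ^+ 2 / r ^+ 2 - chord_of_angle x ^+ 4 / (4 * r ^+ 4) = sin x ^+ 2.
  transitivity (4 * sin (x / 2) ^+ 2 * (1 - sin (x / 2) ^+ 2)).
    by rewrite /chord_of_angle; field; rewrite rn0.
  have -> : 1 - sin (x / 2) ^+ 2 = cos (x / 2) ^+ 2 by apply/eqP; rewrite subr_eq cos2Dsin2.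
  by rewrite sE; ring.
rewrite /chord_formula hE -[sin x ^+ 2]powR_mulrn ?(ltW s0)// -powRrM.
rewrite (_ : 2 * ((n.+2%:R - 3) / 2) = n%:R - 1); last first.
  by rewrite -[n.+2%:R]natr1 -[n.+1%:R]natr1; field.
transitivity (sin x `^ (n%:R - 1) * sin x `^ 1 / sin_integral pi n).
  rewrite powRr1 ?(ltW s0)//; move: (sin x `^ (n%:R - 1)) => u.
  by rewrite /chord_of_angle sE; field; rewrite rn0 (gt_eqF W0).
rewrite -powRD; last by apply/implyP => _; rewrite gt_eqF.
by rewrite subrK powR_mulrn ?(ltW s0).
Qed.

Lemma integral_chord_formula (b : R) : 0 <= b < pi ->
  (\int[mu]_(x in `]chord_of_angle b, (2 * r)%R[) (chord_formula x)%:E =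
   \int[mu]_(x in `]b, pi[) (sin x ^+ n / sin_integral pi n)%:E)%E.
Proof.
move=> /andP[b0 bp].
have Fb0 : 0 <= chord_of_angle b.
  move: b0; rewrite le_eqVlt => /predU1P[<-|b0]; first by rewrite chord_of_angle0.
  rewrite -chord_of_angle0 ltW// chord_of_angle_incr// in_itv/= ?lexx ?pi_ge0//.
  by rewrite !ltW.
rewrite -chord_of_anglepi (ge0_substitution_itvoo bp is_derive_chord_of_angle).
- apply: eq_integral => x; rewrite inE/= in_itv/= => /andP[bx xp].
  by rewrite chord_formula_angle// (le_lt_trans b0).
- move=> x; apply: cvgM; first exact: cvg_cst.
  apply: (@continuous_comp R R R (fun t : R => t / 2) cos).
    by apply: cvgM; [exact: cvg_id|exact: cvg_cst].
  exact: continuous_cos.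
- move=> x y; rewrite !in_itv/= => /andP[bx xp] /andP[by' yp].
  by apply: chord_of_angle_incr; rewrite in_itv/= ?xp ?yp (le_trans b0).
- rewrite chord_of_anglepi => x; rewrite in_itv/= => /andP[bx xr].
  have x0 : 0 < x by exact: le_lt_trans bx.
  have cX k (c : R) : {for x, continuous (fun t : R => t ^+ k / c)}.
    by apply: cvgM; [exact: exprn_continuous|exact: cvg_cst].
  apply: cvgM; first exact: (cX 1%N).
  apply: (@continuous_comp R R R (fun x : R => x ^+ 2 / r ^+ 2 - x ^+ 4 / (4 * r ^+ 4))
    (@powR R ^~ ((n.+2%:R - 3) / 2))).
    by apply: cvgB; exact: cX.
  apply: continuous_powR_gt0.
  (* The factored form shows the base of the real power to be positive on ]0, 2r[, where the power
     is continuous. *)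
  rewrite (_ : _ - _ = x ^+ 2 * (2 * r - x) * (2 * r + x) / (4 * r ^+ 4)); last first.
    by field; rewrite (gt_eqF r0).
  by rewrite divr_gt0 ?mulr_gt0 ?exprn_gt0 ?subr_gt0 ?addr_gt0 ?mulr_gt0.
- move=> x; rewrite in_itv/= => /andP[bx _].
  by rewrite chord_formula_ge0// ltW// (le_lt_trans Fb0).
- move=> x; rewrite in_itv/= => /andP[bx xp]; rewrite mulr_ge0 ?ltW//.
  rewrite cos_gt0_pihalf// ltr_pM2r// xp andbT (@lt_trans _ _ 0) ?oppr_lt0 ?divr_gt0 ?pi_gt0//.
  exact: le_lt_trans bx.
Qed.

Lemma integral_chord_pdf1 : (\int[mu]_x (chord_pdf n.+2 r x)%:E = 1)%E.
Proof.
rewrite integral_chord_pdf setTI -{1}chord_of_angle0 integral_chord_formula ?lexx ?pi_gt0//.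
by rewrite -(integral_angle_pdf n) integral_angle_pdfE setTI.
Qed.

Definition chord_law := @density _ (measurableTypeR R) R mu (chord_pdf n.+2 r)
  measurable_chord_pdf chord_pdf_ge0 integral_chord_pdf1.

HB.instance Definition _ := Probability.on chord_law.

Lemma chord_law_angle (A : set R) : measurable A ->
  chord_law A = angle_law n (chord_of_angle @^-1` A).
Proof.
have mF : measurable_fun setT chord_of_angle.
  by apply: continuous_measurable_fun; exact: continuous_chord_of_angle.
apply: (@eq_tail_distribution R _ _ (measurableTypeR R) (measurableTypeR R) chord_law
  (angle_law n) idfun chord_of_angle) => [||x].
- by move=> _ Y mY; rewrite setTI; exact: mY.
- by move=> _ Y mY; exact: mF.
rewrite /= /chord_law /angle_law /density integral_angle_pdfE integral_chord_pdf.
have [xr|rx] := ltP x (2 * r); last first.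
  rewrite (_ : _ `&` _ = set0) ?integral_set0; last first.
    apply/seteqP; split=> // y [] /=; rewrite /= !in_itv/= andbT => xy /andP[_ yr].
    by move: (lt_le_trans yr rx); rewrite ltNge (ltW xy).
  rewrite (_ : _ `&` _ = set0) ?integral_set0//.
  apply/seteqP; split=> // y [] /=; rewrite /= !in_itv/= andbT => xy /andP[y0 yp].
  have : chord_of_angle y < 2 * r.
    by rewrite -chord_of_anglepi chord_of_angle_incr// in_itv/= ?lexx ?pi_ge0// !ltW.
  by move=> /lt_le_trans /(_ rx); rewrite ltNge (ltW xy).
(* The angle at which the chord reaches x. A negative threshold is raised to 0, no mass being lost
   since both laws charge only positive chords. *)
have [b /[!in_itv]/= /andP[b0 bp] Fb] : exists2 b : R, b \in `[0, pi] & chord_of_angle b = Num.max 0 x.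
  apply: IVT; first exact: pi_ge0.
    exact/continuous_subspaceT/continuous_chord_of_angle.
  have h2 : 0 <= 2 * r by rewrite mulr_ge0 ?(ltW r0).
  rewrite chord_of_angle0 chord_of_anglepi (min_l h2) (max_r h2).
  by rewrite le_max lexx/= ge_max h2 ltW.
have {}bp : b < pi.
  rewrite lt_neqAle bp andbT; apply/eqP => bpi.
  move: Fb; rewrite bpi chord_of_anglepi => /eqP; apply/negP.
  by rewrite gt_eqF// gt_max xr mulr_gt0.
rewrite (_ : _ `&` _ = `]chord_of_angle b, (2 * r)[%classic); last first.
  rewrite Fb; apply/seteqP; split => y /=; rewrite !in_itv/= ?andbT gt_max.
    by move=> [-> /andP[-> ->]].
  by move=> /andP[/andP[-> ->] ->].
rewrite integral_chord_formula ?b0//; congr (\int[_]_(x in _) _)%E.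
apply/seteqP; split => y /=; rewrite !in_itv/= ?andbT.
  move=> /andP[by' yp]; have y0 : 0 < y by exact: le_lt_trans by'.
  rewrite y0 yp; split=> //.
  apply: (@le_lt_trans _ _ (chord_of_angle b)); first by rewrite Fb le_max lexx orbT.
  by rewrite chord_of_angle_incr// in_itv/= ?b0 ?(ltW bp) ?(ltW y0) ?(ltW yp).
move=> [xF /andP[y0 yp]]; rewrite yp andbT ltNge; apply/negP => yb.
have : chord_of_angle y <= chord_of_angle b.
  move: yb; rewrite le_eqVlt => /predU1P[->//|yb].
  by rewrite ltW// chord_of_angle_incr// in_itv/= ?b0 ?(ltW bp) ?(ltW y0) ?(ltW yp).
rewrite Fb leNgt => /negP; apply; rewrite gt_max xF andbT.
by rewrite -chord_of_angle0 chord_of_angle_incr// in_itv/= ?lexx ?pi_ge0// ?(ltW y0) ?(ltW yp).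
Qed.

End chord_law.

(** * From two independent uniform points to the chord law *)

Section chord_length_law.
Context d (T : measurableType d) (R : realType) (P : probability T R) (n : nat)
  (r : R) (X Y : {RV P >-> n.+2.-tuple R}).
Hypotheses (r0 : 0 < r) (unifX : uniform_on_sphere r X) (unifY : uniform_on_sphere r Y).

Let rn0 : r != 0. Proof. by rewrite gt_eqF. Qed.

(** Both sides vanish for odd k. For even k they equal 1 at k = 0 and satisfy the same recursion, as
    the dimension is n + 2. *)
Lemma cosine_momentE y k : dot y y = r ^+ 2 ->
  \int[P]_t (dot (X t) y / r ^+ 2) ^+ k = trig_moment n k / sin_integral pi n.
Proof.
move=> yr; have W0 := @sin_integral_gt0 R n.
have mE : \int[P]_t (dot (X t) y / r ^+ 2) ^+ k = dot_moment X k y * r ^- 2 ^+ k.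
  rewrite /dot_moment -RintegralZr//; last first.
    by apply: ae_bounded_integrable; apply: ae_boundedX; exact: (ae_bounded_dot r0 unifX).
  by apply: eq_Rintegral => t _; rewrite exprMn.
rewrite mE -[k]odd_double_half; case: (odd k) => /=.
  by rewrite add1n trig_moment_odd (dot_moment_odd r0 unifX) !mul0r.
rewrite add0n; elim: (k./2) => [|m IH].
  rewrite /dot_moment trig_moment0 divff ?gt_eqF// mulr1.
  by rewrite (_ : (fun t => _) = cst 1)// Rintegral_cst//= probability_setT mulr1.
have N0 : (n.+2 + m.*2)%:R != 0 :> R by rewrite pnatr_eq0.
apply: (mulfI N0); rewrite mulrA (dot_momentS r0 unifX m yr).
rewrite [RHS]mulrA addSn addSn trig_momentS -[RHS]mulrA -IH.
rewrite doubleS (exprS _ m.*2.+1) (exprS _ m.*2); move: (r ^- 2 ^+ m.*2) => z.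
by field.
Qed.

(** Cauchy-Schwarz for vectors of norm r, read off from |X + y|^2 >= 0 and |X - y|^2 >= 0. *)
Lemma cosine_itv y : dot y y = r ^+ 2 ->
  {ae P, forall t, -1 <= dot (X t) y / r ^+ 2 <= 1}.
Proof.
move=> yr; apply: filterS (ae_uniform_sphere unifX) => t Xt.
have r2 : 0 < r ^+ 2 by rewrite exprn_gt0.
have := dot_ge0 (lincomb 1 (X t) 1 y); have := dot_ge0 (lincomb 1 (X t) (-1) y).
rewrite !(dot_lincombl, dot_lincombr) (dotC y) Xt yr => h1 h2.
by rewrite ler_pdivlMr// ler_pdivrMr//; apply/andP; split; lra.
Qed.

Lemma cosine_law y (A : set R) : dot y y = r ^+ 2 -> measurable A ->
  P ((fun t => dot (X t) y / r ^+ 2) @^-1` A) = angle_law n (cos @^-1` A).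
Proof.
move=> yr; have mcos : measurable_fun setT (@cos R).
  by apply: continuous_measurable_fun; exact: continuous_cos.
apply: (@eq_moments_distribution R _ _ T (measurableTypeR R) P (angle_law n) _ cos (-1) 1).
- by apply: measurable_funM => //; exact: measurable_dotr.
- by move=> _ Z mZ; exact: mcos.
- exact: cosine_itv.
- by apply: aeW => x; rewrite cos_geN1 cos_le1.
- by move=> k; rewrite cosine_momentE// angle_law_cosX.
Qed.

Lemma measurable_eucl_dist : measurable_fun setT (fun t => eucl_dist (Y t) (X t)).
Proof.
under eq_fun do rewrite eucl_distE.
apply: (measurableT_comp (continuous_measurable_fun (@sqrt_continuous R))).
have mdot (U V : {RV P >-> n.+2.-tuple R}) : measurable_fun setT (fun t => dot (U t) (V t)).
  exact: measurable_dot.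
apply: measurable_funD => //; apply: measurable_funB => //.
exact: measurable_funM.
Qed.

Lemma chord_length_law (A : set R) : independent_RV Y X -> measurable A ->
  P ((fun t => eucl_dist (Y t) (X t)) @^-1` A) =
  (\int[lebesgue_measure]_(x in A) (chord_pdf n.+2 r x)%:E)%E.
Proof.
move=> indYX mA.
(* Any fixed point of the sphere would do; this one is r times the first basis vector. *)
pose y := lincomb r (unit_vector R (@ord0 n.+1)) 0 (unit_vector R ord0).
have yr : dot y y = r ^+ 2.
  by rewrite !(dot_lincombl, dot_lincombr) dot_unit_vector tnth_mktuple eqxx/=; ring.
(* Law of cosines: the distance between two points of the sphere as a function of the cosine of
   their angle. *)
pose g c : R := Num.sqrt (2 * r ^+ 2 * (1 - c)).
have mg : measurable_fun setT g.
  apply: (measurableT_comp (continuous_measurable_fun (@sqrt_continuous R))).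
  by apply: measurable_funM => //; exact: measurable_funB.
have mgA : measurable (g @^-1` A) by rewrite -[X in measurable X]setTI; exact: mg.
have mcos : measurable_fun setT (@cos R).
  by apply: continuous_measurable_fun; exact: continuous_cos.
have mdot : measurable_fun setT (fun t => dot (Y t) (X t)) by exact: measurable_dot.
have msc : measurable_fun setT (fun s : R => s / r ^+ 2) by exact: measurable_funM.
transitivity (P ((fun t => dot (Y t) (X t) / r ^+ 2) @^-1` (g @^-1` A))).
  apply: ae_eq_probability.
  - by rewrite -[X in measurable X]setTI; exact: measurable_eucl_dist.
  - have m := measurableT_comp msc mdot.
    by rewrite -[X in measurable X]setTI; exact: m.
  - apply: filterS2 (ae_uniform_sphere unifX) (ae_uniform_sphere unifY) => t Xt Yt /=.
    rewrite eucl_distE Xt Yt /g.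
    rewrite (_ : _ - _ + _ = 2 * r ^+ 2 * (1 - dot (Y t) (X t) / r ^+ 2))//.
    by field.
transitivity (P ((fun t => dot (X t) y / r ^+ 2) @^-1` (g @^-1` A))).
  apply: (dot_independent_law unifX unifY indYX (A := (fun s => s / r ^+ 2) @^-1` (g @^-1` A)) yr).
  by rewrite -[X in measurable X]setTI; exact: msc.
rewrite cosine_law//.
transitivity (angle_law n (chord_of_angle r @^-1` A)); last by rewrite -chord_law_angle.
have mF : measurable_fun setT (chord_of_angle r).
  by apply: continuous_measurable_fun; exact: continuous_chord_of_angle.
apply: (@ae_eq_probability _ (measurableTypeR R) R (angle_law n)).
- by rewrite -[X in measurable X]setTI; exact: mcos.
- by rewrite -[X in measurable X]setTI; exact: mF.
apply: (@filterS _ _ (ae_filter_ringOfSetsType (angle_law n)) _ _ _ (@ae_angle_law R n)) => x.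
rewrite in_itv/= => /andP[x0 xp].
have -> : g (cos x) = chord_of_angle r x; last by [].
have s0 : 0 <= sin (x / 2).
  by rewrite sin_ge0_pi//; apply/andP; split; lra.
(* This is 1 - cos x = 2 sin^2 (x / 2); the square root then returns the chord itself because sin (x
   / 2) >= 0 on ]0, pi[. *)
rewrite /g (_ : 2 * r ^+ 2 * (1 - cos x) = chord_of_angle r x ^+ 2).
  by rewrite sqrtr_sqr ger0_norm// !mulr_ge0// ltW.
have -> : cos x = cos (x / 2 *+ 2) by congr cos; rewrite -mulr_natr; field.
by rewrite cos_mulr2n cos2sin2 /chord_of_angle -mulr_natr; ring.
Qed.

End chord_length_law.

Theorem mainTheorem2 (R : realType) (d : measure_display)
    (T : measurableType d) (P : probability T R) (N : nat) (r : R)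
    (p1 p2 : {RV P >-> N.-tuple R}) :
  (2 <= N)%N -> 0 < r ->
  uniform_on_sphere r p1 -> uniform_on_sphere r p2 -> independent_RV p1 p2 ->
  has_pdf P (fun t => eucl_dist (p1 t) (p2 t)) (chord_pdf N r) /\
  P ((fun t => eucl_dist (p1 t) (p2 t)) @^-1` `[0, 2 * r]) = 1%E.
Proof.
move: p1 p2; case: N => [|[|n]]// p1 p2 _ r0 unif1 unif2 ind12.
split; first split.
- exact: measurable_eucl_dist.
- exact: measurable_chord_pdf.
- exact: chord_pdf_ge0.
- by move=> A; exact: chord_length_law.
(* The density vanishes outside ]0, 2r[, so its integral over [0, 2r] is the total mass 1. *)
rewrite (chord_length_law r0 unif2 unif1 ind12)// -(integral_chord_pdf1 n r0).
rewrite !integral_chord_pdf setTI setIidr// => x /=; rewrite !in_itv/= => /andP[x0 xr].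
by rewrite !ltW.
Qed.
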